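(* The group $\mathcal{G}=\langle a,b \mid a^5=b^4=1,\ a^b=a^3\rangle$ is the smallest non-abelian BI-group which is not a CI-group. That is, $\mathcal{G}$ is a non-abelian finite BI-group, $\mathcal{G}$ is not a CI-group, and every finite non-abelian BI-group which is not a CI-group has order at least $|\mathcal{G}|=20$.
   Context: Here $a^b=b^{-1}ab$. For a group $G$ write $G^*=G\setminus\{1\}$. For an inverse closed subset $S\subseteq G^*$ (i.e. $S=S^{-1}$), $Cay(G,S)$ is the simple undirected graph with vertex set $G$ in which $x,y$ are adjacent iff $x^{-1}y\in S$. For a finite group $G$, an inverse closed $S\subseteq G^*$ and a positive integer $\nu$, put $M_\nu^S=\{\sum_{s\in S}\chi(s) \mid \chi \text{ a complex irreducible character of } G,\ \chi(1)=\nu\}$ (a set, not a multiset). A finite group $G$ is a BI-group if for all inverse closed subsets $S,T$ of $G^*$, a graph isomorphism $Cay(G,S)\cong Cay(G,T)$ implies $M_\nu^S=M_\nu^T$ for all positive integers $\nu$. A finite group $G$ is a CI-group if for all inverse closed subsets $S,T$ of $G^*$, $Cay(G,S)\cong Cay(G,T)$ (as graphs) implies $S^\alpha=T$ for some automorphism $\alpha$ of $G$. *)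

(* Defs.v *)
From mathcomp Require Import all_boot all_order all_algebra.
From mathcomp Require Import all_fingroup all_solvable all_field all_character.
Set Implicit Arguments.
Unset Strict Implicit.
Unset Printing Implicit Defensive.

Import GroupScope.

Section Cayley.

Variables (gT : finGroupType) (G : {group gT}).

Definition connection_set (S : {set gT}) : bool :=
  (S \subset G^#) && (S^-1 == S).

Definition cay (S : {set gT}) : rel gT := fun x y => x^-1 * y \in S.

(* The vertex set of both graphs is G, so f only matters on G. *)
Definition cay_iso (S T : {set gT}) : Prop :=
  exists f : gT -> gT,
    [/\ {in G &, injective f}, f @: G = G
      & {in G &, forall x y, cay T (f x) (f y) = cay S x y}].

(* Compared with =i, so that multiplicities are ignored. *)
Definition char_sums (nu : nat) (S : {set gT}) : seq algC :=
  [seq \sum_(s in S) 'chi[G]_i s | i <- enum (Iirr G) & 'chi[G]_i 1%g == nu%:R]%R.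

Definition BI_group : Prop :=
  forall S T : {set gT}, connection_set S -> connection_set T ->
    cay_iso S T ->
    forall nu : nat, (0 < nu)%N -> char_sums nu S =i char_sums nu T.

Definition CI_group : Prop :=
  forall S T : {set gT}, connection_set S -> connection_set T ->
    cay_iso S T -> exists2 alpha, alpha \in Aut G & alpha @: S = T.

End Cayley.

(* Main.v *)
Require Import Defs.
From Stdlib Require Import BinNat.
From mathcomp Require Import all_boot all_order all_algebra.
From mathcomp Require Import all_fingroup all_solvable all_field all_character.
Set Implicit Arguments.
Unset Strict Implicit.
Unset Printing Implicit Defensive.

Import GroupScope.

(** Write F20 for the group with the presentation of the theorem, the Frobenius
    group of order 20.

    Small BI-groups. For subgroups A and B of the same order, the connection sets
    A - {1} and B - {1} both give disjoint unions of complete graphs. If G is a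
    BI-group, comparing the character sums shows that B is normal as soon as A is
    ([BI_normal]) and that B contains the derived subgroup as soon as A does
    ([BI_der1]). This removes most non-abelian groups of order less than 20: among
    2-groups only the quaternion group of order 8 is left, in order 12 the dihedral
    group falls, in order 18 the product of a cyclic group of order 3 with the
    symmetric group. What remains are the dihedral groups of order 6, 10, 14 and
    18, the generalised dihedral group of order 18, the quaternion group, the
    dicyclic group of order 12 and the alternating group of degree 4.

    All these are CI-groups. In fact two inverse closed subsets whose Cayley graphs
    have the same spectrum are already conjugate under an automorphism. The numbers
    of closed walks at the identity are invariants of the graph (they are the
    moments of its spectrum, see [closed_walk_iso]), so it suffices to compute them
    for one subset in each orbit of the automorphism group, and to see that they
    differ. Each group is put in the normal form a1^i a2^j b^k, which gives a
    multiplication table on which the computation is run ([CI_checkP],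
    [tabulates_presented]).

    The group F20. An inverse closed subset S contributes to a character sum only
    through the numbers of its elements of order 2, 4 and 5, because all elements
    of one of these orders are conjugate up to inversion. The spectrum determines
    these numbers, which is again verified on closed walks ([BI_checkP], [F20_BI]).
    So F20 is a BI-group. It is not a CI-group: [F20_not_CI] exhibits two connection
    sets with isomorphic graphs in different orbits of the automorphism group. *)

(** * Cayley graphs and closed walks *)

Section CayleyGraphs.

Variables (gT : finGroupType) (G : {group gT}).
Implicit Types (S T : {set gT}) (alpha : {perm gT}) (g : gT).

Lemma connection_sub S : connection_set G S -> S \subset G.
Proof. by case/andP=> /subset_trans-> //; apply: subsetDl. Qed.

Lemma aut_iso S alpha : alpha \in Aut G -> S \subset G -> cay_iso G S (alpha @: S).
Proof.
move=> Aa sSG; exists alpha; split.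
- by move=> x y _ _; apply: perm_inj.
- by have := im_autm Aa; rewrite morphimEdom.
move=> x y Gx Gy; rewrite /cay -(autmE Aa) -morphV // -morphM ?groupV //=.
by rewrite mem_imset //; apply: perm_inj.
Qed.

Lemma connection_set_aut S alpha : alpha \in Aut G -> connection_set G S ->
  connection_set G (alpha @: S).
Proof.
move=> Aa /andP[/subsetP sSG /eqP SV].
have aG x: x \in G -> alpha x \in G by move=> Gx; rewrite Aut_closed.
apply/andP; split.
  apply/subsetP=> _ /imsetP[x /sSG + ->]; rewrite !inE => /andP[ntx Gx].
  rewrite aG // andbT; apply: contraNneq ntx => ax1.
  by rewrite -(inj_eq (@perm_inj _ alpha)) ax1 -(autmE Aa) morph1.
have aV x: x \in G -> alpha x^-1 = (alpha x)^-1.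
  by move=> Gx; rewrite -(autmE Aa) morphV.
have sub: alpha @: S \subset (alpha @: S)^-1.
  apply/subsetP=> _ /imsetP[x Sx ->]; rewrite inE -aV ?imset_f //.
    by rewrite -SV inE invgK.
  by case/setD1P: (sSG x Sx).
by rewrite eq_sym eqEcard sub card_invg leqnn.
Qed.

Lemma conj_iso S g : g \in G -> cay_iso G S (S :^ g).
Proof.
move=> Gg; exists (conjg^~ g); split.
- by move=> x y _ _; apply: conjg_inj.
- exact: conjGid.
by move=> x y _ _; rewrite /cay -conjVg -conjMg memJ_conjg.
Qed.

Lemma connection_set_conj S g : g \in G -> connection_set G S -> connection_set G (S :^ g).
Proof.
move=> Gg /andP[sSG /eqP SV]; apply/andP; split; last first.
  by apply/eqP/setP=> x; rewrite inE !mem_conjg conjVg -mem_invg SV.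
by rewrite -(conjGid Gg) -conjD1g conjSg.
Qed.

Fixpoint walk S l (x : gT) : nat :=
  if l is l'.+1 then \sum_(s in S) walk S l' (x * s) else (x == 1).

Lemma walkS S l x : S \subset G -> x \in G ->
  walk S l.+1 x = \sum_(y in G | cay S x y) walk S l y.
Proof.
move=> sSG Gx; rewrite /= (reindex_inj (mulgI x^-1)) /=.
apply: eq_big => y; last by rewrite mulKVg.
rewrite /cay; case Sy: (_ \in S); rewrite ?andbF // andbT.
by rewrite -(groupMl _ (groupVr Gx)) (subsetP sSG).
Qed.

(** Left translations are automorphisms of every Cayley graph, so an isomorphism
    can be moved to one that fixes the identity. *)
Lemma cay_iso_fix1 S T : cay_iso G S T -> exists f : gT -> gT,
  [/\ f 1 = 1, {in G &, injective f}, f @: G = G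
    & {in G &, forall x y, cay T (f x) (f y) = cay S x y}].
Proof.
case=> f [injf fG cayf]; have Gf x: x \in G -> f x \in G.
  by move=> Gx; rewrite -[in X in _ \in X]fG imset_f.
exists (fun x => (f 1)^-1 * f x); split=> [|x y Gx Gy /mulgI/injf->//||x y Gx Gy].
- by rewrite mulVg.
- apply/eqP; rewrite eqEcard; apply/andP; split.
    by apply/subsetP=> _ /imsetP[x Gx ->]; rewrite groupM ?groupV ?Gf.
  by rewrite card_in_imset // => x y Gx Gy /mulgI/injf->.
by rewrite -cayf // /cay invMg invgK mulgA mulgK.
Qed.

(** An isomorphism that fixes 1 maps the walks from [x] to 1 to walks from its
    image to 1. By vertex transitivity these counts, times the order of the group,
    are the power sums of the eigenvalues: they see exactly the spectrum. *)
Lemma closed_walk_iso S T l : S \subset G -> T \subset G -> cay_iso G S T ->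
  walk T l 1 = walk S l 1.
Proof.
move=> sSG sTG /cay_iso_fix1[f [f1 injf fG cayf]].
have Gf x: x \in G -> f x \in G.
  by move=> Gx; rewrite -[in X in _ \in X]fG imset_f.
rewrite -[1 in LHS]f1; have := group1 G; move: 1.
elim: l => [|l IHl] x Gx.
  by rewrite /= -[in LHS]f1 (inj_in_eq injf) ?group1.
rewrite !walkS ?Gf // -[in LHS]fG big_mkcondr big_imset //= [RHS]big_mkcondr /=.
by apply: eq_bigr => y Gy; rewrite cayf // IHl.
Qed.

End CayleyGraphs.

(** * What the BI property says about subgroups *)

Section Subgroups.

Variables (gT : finGroupType) (G : {group gT}).
Implicit Types A B : {group gT}.

Lemma nth_index_inj (aT rT : eqType) (x0 : rT) (s : seq aT) (t : seq rT) :
    uniq t -> size s = size t ->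
  {in s, forall x, nth x0 t (index x s) \in t} /\
  {in s &, injective (fun x => nth x0 t (index x s))}.
Proof.
move=> Ut sz_st; split=> [x sx | x y sx sy /eqP].
  by rewrite mem_nth // -sz_st index_mem.
rewrite nth_uniq -?sz_st ?index_mem // => /eqP Exy.
by rewrite -(nth_index x sx) Exy nth_index.
Qed.

Lemma repr_lcoset A x : repr (x *: A) \in x *: A.
Proof. exact: mem_repr (lcoset_refl A x). Qed.

(** Both graphs are disjoint unions of complete graphs on #|A| vertices, one for
    each left coset. The isomorphism matches the cosets of A with those of B, and
    inside a coset it matches the translates of the elements of A and of B. *)
Lemma cay_iso_subgroups A B : A \subset G -> B \subset G -> #|A| = #|B| ->
  cay_iso G A^# B^#.
Proof.
move=> sAG sBG cardAB.
have szAB : size (enum A) = size (enum B) by rewrite -!cardE.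
have szl : size (enum (lcosets A G)) = size (enum (lcosets B G)).
  by rewrite -!cardE !card_lcosets -!divgS // cardAB.
have [phiB phi_inj] := nth_index_inj 1 (enum_uniq B) szAB.
have [psiB psi_inj] := nth_index_inj set0 (enum_uniq (lcosets B G)) szl.
set phi := fun a => nth 1 (enum B) _ in phi_inj.
set psi := fun X => nth set0 (enum (lcosets B G)) _ in psi_inj.
have lA x : x \in G -> x *: A \in enum (lcosets A G).
  by move=> Gx; rewrite mem_enum; apply/lcosetsP; exists x.
pose a x := (repr (x *: A))^-1 * x.
have aA x : a x \in A.
  by rewrite -mem_lcoset (lcoset_eqP (repr_lcoset A x)) lcoset_refl.
pose f x := repr (psi (x *: A)) * phi (a x).
have fB x : x \in G -> f x *: B = psi (x *: A) /\ f x \in G.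
  move=> Gx; have := psiB _ (lA x Gx); rewrite -/(psi _) mem_enum.
  case/lcosetsP=> y Gy Ey.
  have phia : phi (a x) \in B by rewrite -mem_enum; apply: phiB; rewrite mem_enum.
  have ry := repr_lcoset B y.
  have fy: f x \in y *: B.
    rewrite /f Ey; case/lcosetP: ry => b Bb ->.
    by rewrite -mulgA mem_lcoset mulKg; apply: groupM.
  rewrite Ey (lcoset_eqP fy); split=> //.
  by case/lcosetP: fy => b Bb ->; apply: (groupM Gy (subsetP sBG b Bb)).
have cosetE (K : {group gT}) x y : (x^-1 * y \in K) = (x *: K == y *: K).
  by rewrite -mem_lcoset; apply/lcoset_eqP/eqP => [-> | ->].
have f_inj : {in G &, injective f}.
  move=> x y Gx Gy fxy.
  have Exy : x *: A = y *: A.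
    apply: (psi_inj _ _ (lA x Gx) (lA y Gy)).
    rewrite -/(psi (x *: A)) -/(psi (y *: A)).
    by have [<- _] := fB x Gx; have [<- _] := fB y Gy; rewrite fxy.
  move: fxy; rewrite /f Exy => /mulgI/phi_inj; rewrite !mem_enum => /(_ (aA x) (aA y)).
  by rewrite /a Exy => /mulgI.
exists f; split=> // [|x y Gx Gy].
  apply/eqP; rewrite eqEcard card_in_imset // leqnn andbT.
  by apply/subsetP=> _ /imsetP[x Gx ->]; case: (fB x Gx).
rewrite /cay !inE !cosetE -!eq_mulVg1 (inj_in_eq f_inj) //; congr (_ && _).
have [-> _] := fB x Gx; have [-> _] := fB y Gy.
by apply/eqP/eqP=> [/(psi_inj _ _ (lA x Gx) (lA y Gy)) | ->].
Qed.

Lemma constt0_Res_sum A (chi : 'CF(G)) : A \subset G ->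
  ((0 : Iirr A) \in irr_constt ('Res[A] chi))%R = (\sum_(x in A) chi x != 0)%R.
Proof.
move=> sAG; rewrite irr_consttE irr0 cfdotE GRing.mulf_eq0 GRing.invr_eq0.
rewrite (negbTE (neq0CG A)) /=; congr (_ != _); apply: eq_bigr => x Ax.
by rewrite cfResE // cfun1E Ax Num.Theory.conjC1 GRing.mulr1.
Qed.

(** The core of A is the kernel of the permutation character on the cosets of A,
    whose irreducible constituents are, by Frobenius reciprocity, those that do
    not sum to zero over A. *)
Lemma sub_gcore_char (K : {set gT}) A : K \subset G -> A \subset G ->
    (forall i, (\sum_(x in A) 'chi[G]_i x != 0)%R -> K \subset cfker ('chi_i)%R) ->
  K \subset gcore A G.
Proof.
move=> sKG sAG kerK; rewrite -(cfker_irr0 A) -cfker_Ind_irr //.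
rewrite cfkerE ?cfInd_char ?irr_char // subsetI sKG; apply/bigcapsP=> i.
by rewrite constt_Ind_Res constt0_Res_sum //; apply: kerK.
Qed.

Hypothesis BI : BI_group G.

(** The BI property applied to the connection sets of [cay_iso_subgroups]; the
    identity contributes the same degree on both sides. *)
Lemma BI_subgroup_sums A B : A \subset G -> B \subset G -> #|A| = #|B| ->
  forall i, exists2 j, ('chi[G]_j 1%g = 'chi[G]_i 1%g)%R &
    (\sum_(x in A) 'chi_j x = \sum_(x in B) 'chi_i x)%R.
Proof.
move=> sAG sBG cardAB i.
have conn (K : {group gT}) : K \subset G -> connection_set G K^#.
  move=> sKG; rewrite /connection_set setSD //; apply/eqP/setP=> x.
  by rewrite !inE groupV invg_eq1.
have [nu chi1 nu_gt0] : exists2 nu, ('chi[G]_i 1%g = nu%:R)%R & 0 < nu.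
  by rewrite irr1_degree; set d := irr_degree _; exists d; last exact: irr_degree_gt0.
have := BI (conn _ sAG) (conn _ sBG) (cay_iso_subgroups sAG sBG cardAB) nu_gt0.
move=> /(_ (\sum_(s in B^#) 'chi_i s)%R) => memAB.
have /mapP[j] : (\sum_(s in B^#) 'chi_i s)%R \in char_sums G nu A^#.
  by rewrite memAB; apply/mapP; exists i; rewrite // mem_filter chi1 eqxx mem_enum.
rewrite mem_filter => /andP[/eqP chij1 _] sumij.
exists j; first by rewrite chij1 chi1.
by rewrite !(big_setD1 1%g (group1 _)) /= -sumij chij1 chi1.
Qed.

(** Over a normal subgroup every irreducible character sums to 0 or to its degree
    times the order, by Clifford's theorem. [BI_subgroup_sums] carries this
    dichotomy over to B, so every constituent of the permutation character on the
    cosets of B contains B in its kernel, and B equals its own core. *)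
Lemma BI_normal A B : A <| G -> B \subset G -> #|A| = #|B| -> B <| G.
Proof.
move=> nsAG sBG cardAB; have sAG := normal_sub nsAG.
suffices sBcore : B \subset gcore B G.
  have -> : B = gcore_group B G.
    by apply/val_inj/eqP; rewrite eqEsubset sBcore gcore_sub.
  exact: gcore_normal.
apply: sub_gcore_char => // i nz_i.
have [j chi1 sum_ij] := BI_subgroup_sums sAG sBG cardAB i; rewrite -sum_ij in nz_i.
have kerA : A \subset cfker ('chi_j)%R by rewrite constt0_Res_cfker // constt0_Res_sum.
have sumA : (\sum_(x in A) 'chi_j x = \sum_(x in B) 'chi_i 1%g)%R.
  rewrite -chi1 GRing.sumr_const -cardAB -GRing.sumr_const; apply: eq_bigr => x Ax.
  by rewrite cfker1 // (subsetP kerA).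
(* A sum of values of modulus at most chi(1) that adds up to the maximum has
   all its terms maximal. *)
have /Num.Theory.normC_sum_upper chiB:
    (\sum_(x in B) 'chi_i x = \sum_(x in B) 'chi_i 1%g)%R.
  by rewrite -sum_ij.
apply/subsetP=> x Bx; rewrite cfkerEirr inE chiB // => y By.
exact: char1_ge_norm (irr_char i).
Qed.

(** Since A contains the derived subgroup, only linear characters can have a
    nonzero sum over A, hence over B: the permutation character on the cosets of B
    is a sum of linear characters. *)
Lemma BI_der1 A B : G^`(1) \subset A -> A \subset G -> B \subset G -> #|A| = #|B| ->
  G^`(1) \subset B.
Proof.
move=> sG'A sAG sBG cardAB; apply: subset_trans (gcore_sub B G).
apply: sub_gcore_char; rewrite ?der_sub // => i nz_i.
have [j chi1 sum_ij] := BI_subgroup_sums sAG sBG cardAB i; rewrite -sum_ij in nz_i.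
have kerA : A \subset cfker ('chi_j)%R.
  by rewrite constt0_Res_cfker ?constt0_Res_sum // sub_der1_normal.
have := subset_trans sG'A kerA; rewrite -!lin_irr_der1 !qualifE /= !irr_char /=.
by rewrite chi1.
Qed.

End Subgroups.

(** * Groups given by a multiplication table *)

Section Tables.

Variable T : seq (seq nat).
Local Notation n := (size T).

Definition tab_mul i j := nth 0 (nth [::] T i) j.
Definition tab_inv i := find (fun j => tab_mul i j == 0) (iota 0 n).
(** A connection set is a union of classes {g, g^-1} of nontrivial elements. Each
    class is represented by its smallest index, and a connection set is encoded by
    one bit per class. *)
Definition inv_reps := [seq i <- iota 1 n.-1 | i <= tab_inv i].
Definition inv_class i := index (minn i (tab_inv i)) inv_reps.
(** Entry (i, j) is the class of i^-1 j, so that the adjacency matrix is read off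
    by looking up bits. *)
Definition quotient_classes :=
  [seq [seq inv_class (tab_mul (tab_inv i) j) | j <- iota 0 n] | i <- iota 0 n].

(** A row of a 0-1 matrix times a vector, in binary arithmetic: the numbers of
    walks grow exponentially with the length. *)
Fixpoint masked_sum (r : bitseq) (v : seq N) : N :=
  match r, v with
  | b :: r', a :: v' => if b then N.add a (masked_sum r' v') else masked_sum r' v'
  | _, _ => 0%num
  end.

(** Power iteration on the adjacency matrix, started at the indicator vector of
    the identity, whose index is 0. *)
Definition closed_walks (D : seq (seq nat)) len (s : bitseq) :=
  let rows := [seq [seq nth false s k | k <- d] | d <- D] in
  [seq head 0%num v | v <- traject (fun v => [seq masked_sum r v | r <- rows])
                                   (1%num :: nseq (size D).-1 0%num) len].

(** The bits of the preimage of a set under a map, given for each class the class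
    of its image. *)
Definition pull_bits (cs : seq nat) (s : bitseq) := [seq nth false s k | k <- cs].
Definition class_table := [seq inv_class i | i <- iota 0 n].
Definition class_map (cl cr a : seq nat) := [seq nth 0 cl (nth 0 a r) | r <- cr].

Definition is_tab_bij (a : seq nat) := [&& size a == n, uniq a & all (gtn n) a].

Definition is_tab_aut (a : seq nat) :=
  is_tab_bij a && all (fun i => all (fun j =>
    tab_mul (nth 0 a i) (nth 0 a j) == nth 0 a (tab_mul i j)) (iota 0 n)) (iota 0 n).

Definition is_tab_iso (a : seq nat) (s t : bitseq) :=
  is_tab_bij a && all (fun i => all (fun j =>
    nth false t (inv_class (tab_mul (tab_inv (nth 0 a i)) (nth 0 a j)))
      == nth false s (inv_class (tab_mul (tab_inv i) j))) (iota 0 n)) (iota 0 n).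

Variables (gT : finGroupType) (G : {group gT}) (e : nat -> gT).

Definition tabulates :=
  [/\ e 0 = 1, {in gtn n &, injective e}, G :=: [set:: [seq e i | i <- iota 0 n]]
    & {in gtn n &, forall i j, (tab_mul i j < n) /\ e (tab_mul i j) = e i * e j}].

Hypothesis tabT : tabulates.

Let e0 : e 0 = 1. Proof. by case: tabT. Qed.
Let injE : {in gtn n &, injective e}. Proof. by case: tabT. Qed.
Let opP i j : i < n -> j < n -> (tab_mul i j < n) /\ e (tab_mul i j) = e i * e j.
Proof. by case: tabT => _ _ _; apply. Qed.
Lemma tab_mem i : i < n -> e i \in G.
Proof.
case: tabT => _ _ -> _ lti; rewrite inE; apply/mapP; exists i => //.
by rewrite mem_iota.
Qed.

Definition tab_code g := index g [seq e i | i <- iota 0 n].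

Lemma tab_codeP g : g \in G -> tab_code g < n /\ e (tab_code g) = g.
Proof.
case: tabT => _ _ -> _; rewrite inE => Gg.
have lti: tab_code g < n.
  by rewrite -index_mem size_map size_iota in Gg.
by split=> //; rewrite -[RHS](nth_index 1 Gg) (nth_map 0) ?size_iota // nth_iota.
Qed.

Lemma tab_codeK i : i < n -> tab_code (e i) = i.
Proof. by move=> lti; case: (tab_codeP (tab_mem lti)) => ltc /injE; apply. Qed.

Lemma tab_gt0 : 0 < n.
Proof. by case: (tab_codeP (group1 G)) => /(leq_trans _)->. Qed.

Lemma tab_invP i : i < n -> tab_inv i < n /\ e (tab_inv i) = (e i)^-1.
Proof.
move=> lti; have [ltj ej] := tab_codeP (groupVr (tab_mem lti)).
have hasj: has (fun j => tab_mul i j == 0) (iota 0 n).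
  apply/hasP; exists (tab_code (e i)^-1); first by rewrite mem_iota.
  have [lto eo] := opP lti ltj.
  by apply/eqP; apply: injE; rewrite ?inE ?tab_gt0 // eo ej mulgV e0.
have lt: tab_inv i < n by rewrite -[X in _ < X](size_iota 0) -has_find.
split=> //; have /= := nth_find 0 hasj; rewrite nth_iota // add0n => /eqP.
case: (opP lti lt) => _ eo o0; apply/esym/eqP.
by rewrite eq_invg_mul -eo -e0 -o0.
Qed.

Let lt_iota i : i \in iota 0 n -> i < n. Proof. by rewrite mem_iota. Qed.

Lemma tab_invK i : i < n -> tab_inv (tab_inv i) = i.
Proof.
move=> lti; have [ltj ej] := tab_invP lti; have [ltk ek] := tab_invP ltj.
by apply: injE => //; rewrite ek ej invgK.
Qed.

Lemma tab_uniq : uniq [seq e i | i <- iota 0 n].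
Proof.
rewrite map_inj_in_uniq ?iota_uniq //.
by move=> i j; rewrite !mem_iota => lti ltj; apply: injE.
Qed.

Definition set_of_bits (s : bitseq) := [set g in G | nth false s (inv_class (tab_code g))].
Definition bits_of_set (S : {set gT}) := [seq e r \in S | r <- inv_reps].

Lemma mem_inv_reps r : r \in inv_reps = (0 < r < n) && (r <= tab_inv r).
Proof.
rewrite mem_filter andbC mem_iota; congr (_ && _); by case: (n) tab_gt0.
Qed.

Lemma inv_class_inv i : i < n -> inv_class (tab_inv i) = inv_class i.
Proof. by move=> lti; rewrite /inv_class tab_invK // minnC. Qed.

Lemma inv_class_rep r : r \in inv_reps -> inv_class r = index r inv_reps.
Proof. by rewrite mem_inv_reps => /andP[_ /minn_idPl Er]; rewrite /inv_class Er. Qed.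

(** The index of the class of the identity is out of range: its bit is read as
    [false], as befits a connection set. *)
Lemma inv_class0 : inv_class 0 = size inv_reps.
Proof.
by rewrite /inv_class min0n memNindex // mem_inv_reps.
Qed.

Lemma inv_classP i : 0 < i < n ->
  exists2 r, r \in inv_reps /\ inv_class i = index r inv_reps & e r = e i \/ e r = (e i)^-1.
Proof.
case/andP=> i_gt0 lti; have [ltj ej] := tab_invP lti.
have j_gt0: 0 < tab_inv i.
  rewrite lt0n; apply: contraTneq i_gt0 => j0; move/esym/eqP: ej.
  by rewrite j0 e0 invg_eq1 -e0 (inj_in_eq injE) ?inE ?tab_gt0 // => /eqP->.
exists (minn i (tab_inv i)).
  split=> //; rewrite mem_inv_reps; case: (leqP i (tab_inv i)) => [le_ij | lt_ji].
    by rewrite i_gt0 lti le_ij.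
  by rewrite j_gt0 ltj tab_invK // ltnW.
by case: (leqP i (tab_inv i)) => _; [left | right].
Qed.

Lemma set_of_bits_sub s : set_of_bits s \subset G.
Proof. by apply/subsetP=> g; rewrite inE => /andP[]. Qed.

Lemma connection_set_of_bits s : size s = size inv_reps -> connection_set G (set_of_bits s).
Proof.
move=> sz_s; apply/andP; split.
  apply/subsetP=> g; rewrite !inE => /andP[Gg]; rewrite Gg andbT.
  apply: contraTneq => ->; rewrite -[in tab_code _]e0 tab_codeK ?tab_gt0 //.
  by rewrite inv_class0 nth_default ?sz_s.
apply/eqP/setP=> g; rewrite !inE groupV; case Gg: (g \in G) => //=.
have [lti ei] := tab_codeP Gg; rewrite -[in LHS]ei.
by have [ltj <-] := tab_invP lti; rewrite tab_codeK // inv_class_inv.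
Qed.

Lemma set_of_bitsK S : connection_set G S -> set_of_bits (bits_of_set S) = S.
Proof.
case/andP=> /subsetP sSG /eqP SV; apply/setP=> g; rewrite inE.
have [Gg | notGg] := boolP (g \in G); last first.
  by apply/esym/(contraNF _ notGg) => /sSG/setD1P[].
have [lti ei] := tab_codeP Gg; rewrite /=.
have [i0 | i_gt0] := posnP (tab_code g).
  rewrite i0 inv_class0 nth_default ?size_map // -ei i0 e0.
  by apply/esym/negbTE/negP=> /sSG; rewrite !inE eqxx.
have [|r [rC ->] er] := @inv_classP (tab_code g); first by rewrite i_gt0.
rewrite (nth_map 0) ?index_mem // nth_index // -[in RHS]ei.
by case: er => -> //; rewrite -[S in RHS]SV inE.
Qed.

Lemma bits_of_setK s : size s = size inv_reps -> bits_of_set (set_of_bits s) = s.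
Proof.
move=> sz_s; apply: (@eq_from_nth _ false); rewrite size_map // => j ltj.
rewrite (nth_map 0) // inE; have rC := mem_nth 0 ltj.
have /andP[/andP[_ ltr] _] := etrans (esym (mem_inv_reps _)) rC.
by rewrite tab_mem // tab_codeK // inv_class_rep // index_uniq // filter_uniq ?iota_uniq.
Qed.

Lemma size_bits_of_set S : size (bits_of_set S) = size inv_reps.
Proof. by rewrite size_map. Qed.

Lemma mem_set_of_bits s i : i < n -> (e i \in set_of_bits s) = nth false s (inv_class i).
Proof. by move=> lti; rewrite inE tab_mem // tab_codeK. Qed.

Lemma masked_sumE (p : pred nat) (F : nat -> N) l :
  masked_sum [seq p j | j <- l] [seq F j | j <- l] = \sum_(j <- l | p j) F j :> nat.
Proof.
elim: l => [|j l IHl] /=; first by rewrite big_nil.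
rewrite big_cons; case: (p j) => //; rewrite -IHl.
by case: (F j) (masked_sum _ _) => [|a] [|b] //=; rewrite ?addn0 ?nat_of_add_pos.
Qed.

Lemma closed_walksE len s :
  closed_walks quotient_classes len s =
    [seq bin_of_nat (walk (set_of_bits s) l 1) | l <- iota 0 len].
Proof.
pose v l := [seq bin_of_nat (walk (set_of_bits s) l (e i)) | i <- iota 0 n].
pose rows := [seq [seq nth false s k | k <- d] | d <- quotient_classes].
pose F (v : seq N) := [seq masked_sum r v | r <- rows].
have Fv l: F (v l) = v l.+1.
  rewrite /F /rows /v -!map_comp; apply/eq_in_map=> i /lt_iota lti /=.
  rewrite -[LHS]nat_of_binK; congr bin_of_nat; rewrite -map_comp masked_sumE /=.
  rewrite -[RHS]/(walk _ l.+1 _) (walkS _ (set_of_bits_sub s)) ?tab_mem //.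
  have [_ _ defG _] := tabT; rewrite [RHS]big_mkcondr defG.
  under [RHS]eq_bigl => y do rewrite inE.
  rewrite -big_uniq ?tab_uniq //= big_map big_mkcond [RHS]big_seq [LHS]big_seq.
  apply: eq_bigr => j /lt_iota ltj; have [lti' ei'] := tab_invP lti.
  have [lto eo] := opP lti' ltj.
  by rewrite /cay -ei' -eo mem_set_of_bits // bin_of_natK.
have v0: v 0 = 1%num :: nseq n.-1 0%num.
  rewrite /v; case: (n) tab_gt0 injE => // m _ inj_e /=; rewrite e0 eqxx; congr cons.
  apply: (@eq_from_nth _ 0%num); rewrite size_map size_iota ?size_nseq // => j ltj.
  rewrite nth_nseq (nth_map 0) ?size_iota // nth_iota // ltj -e0.
  by rewrite (inj_in_eq inj_e).
rewrite /closed_walks size_map size_iota -v0 -/rows -/F.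
have ->: traject F (v 0) len = [seq v l | l <- iota 0 len].
  by elim: len 0 => //= len IHlen k; rewrite Fv IHlen.
rewrite -map_comp; apply/eq_in_map=> l _ /=.
by rewrite /v; case: (n) tab_gt0 => //= m _; rewrite e0.
Qed.

Lemma all_tab_pairsP (p : nat -> nat -> bool) i j :
  all (fun i => all (p i) (iota 0 n)) (iota 0 n) -> i < n -> j < n -> p i j.
Proof.
by move=> /allP all_p lti ltj; have /allP-> := all_p i (etrans (mem_iota 0 n i) lti);
  rewrite ?mem_iota.
Qed.

Definition tab_fun (a : seq nat) g := e (nth 0 a (tab_code g)).

Lemma nth_tab_bij a i : is_tab_bij a -> i < n -> nth 0 a i < n.
Proof. by case/and3P=> /eqP sz_a _ /allP lt_a lti; apply/lt_a/mem_nth; rewrite sz_a. Qed.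

Lemma tab_fun_bij a : is_tab_bij a -> {in G &, injective (tab_fun a)} /\ tab_fun a @: G = G.
Proof.
move=> bij_a; have /and3P[/eqP sz_a Ua _] := bij_a.
have inj_f: {in G &, injective (tab_fun a)}.
  move=> g h Gg Gh /injE; have [lti ei] := tab_codeP Gg; have [ltj ej] := tab_codeP Gh.
  rewrite !inE !nth_tab_bij // => /(_ isT isT)/eqP.
  by rewrite nth_uniq ?sz_a // => /eqP eij; rewrite -ei eij.
split=> //; apply/eqP; rewrite eqEcard card_in_imset // leqnn andbT.
by apply/subsetP=> _ /imsetP[g Gg ->]; rewrite tab_mem ?nth_tab_bij //; case: (tab_codeP Gg).
Qed.

Lemma is_tab_autP a : is_tab_aut a ->
  exists2 alpha, alpha \in Aut G & forall i, i < n -> alpha (e i) = e (nth 0 a i).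
Proof.
case/andP=> bij_a aM; have [inj_f fG] := tab_fun_bij bij_a.
have fM: {in G &, {morph tab_fun a : g h / g * h}}.
  move=> g h Gg Gh; have [lti ei] := tab_codeP Gg; have [ltj ej] := tab_codeP Gh.
  rewrite /tab_fun -[in LHS]ei -[in LHS]ej; have [lto <-] := opP lti ltj; rewrite tab_codeK //.
  have /eqP <- := all_tab_pairsP aM lti ltj.
  by case: (opP (nth_tab_bij bij_a lti) (nth_tab_bij bij_a ltj)).
pose fm := Morphism fM; have injfm: 'injm fm by apply/injmP.
have fmG: fm @* G = G by rewrite morphimEdom.
exists (aut injfm fmG); first exact: Aut_aut.
by move=> i lti; rewrite autE ?tab_mem //= /tab_fun tab_codeK.
Qed.

Lemma is_tab_isoP a s t : is_tab_iso a s t -> cay_iso G (set_of_bits s) (set_of_bits t).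
Proof.
case/andP=> bij_a a_iso; have [inj_f fG] := tab_fun_bij bij_a.
exists (tab_fun a); split=> // g h Gg Gh.
have [lti ei] := tab_codeP Gg; have [ltj ej] := tab_codeP Gh.
have cayE i j q : i < n -> j < n ->
    cay (set_of_bits q) (e i) (e j) = nth false q (inv_class (tab_mul (tab_inv i) j)).
  move=> lti' ltj'; have [ltv ev] := tab_invP lti'; have [lto eo] := opP ltv ltj'.
  by rewrite /cay -ev -eo mem_set_of_bits.
rewrite -[in RHS]ei -[in RHS]ej !cayE ?nth_tab_bij //.
exact/eqP/(all_tab_pairsP a_iso).
Qed.

Lemma bits_of_preim (a : seq nat) (alpha : gT -> gT) s :
  (forall i, i < n -> alpha (e i) = e (nth 0 a i)) -> (forall i, i < n -> nth 0 a i < n) ->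
  pull_bits (class_map class_table inv_reps a) s = bits_of_set (alpha @^-1: set_of_bits s).
Proof.
move=> aE lta; rewrite /pull_bits -map_comp; apply/eq_in_map=> r.
rewrite mem_inv_reps => /andP[/andP[_ ltr] _] /=.
by rewrite (nth_map 0) ?size_iota ?lta // nth_iota ?lta // inE aE // mem_set_of_bits ?lta.
Qed.

End Tables.

(** * Deciding the CI and BI properties on a table *)

Fixpoint all_bits k : seq bitseq :=
  if k is k'.+1 then
    [seq b :: s | b <- [:: true; false], s <- all_bits k']
  else [:: [::]].

(** Only used to select orbit representatives; whether the selected sequences do
    represent every orbit is tested separately, by [covers]. *)
Fixpoint lexle (s t : bitseq) :=
  match s, t with
  | b :: s', c :: t' => if b == c then lexle s' t' else c
  | _, _ => true
  end.

(** Splitting [L] by the first bit takes one pass over [L] for each bit, instead of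
    one search in [L] for each bit sequence. *)
Fixpoint covers k (L : seq bitseq) :=
  if k is k'.+1 then
    covers k' [seq behead s | s <- L & head false s] &&
    covers k' [seq behead s | s <- L & ~~ head false s]
  else L != [::].

Lemma coversP k L s : covers k L -> {in L, forall t, size t = k} -> size s = k ->
  s \in L.
Proof.
elim: k L s => [|k IHk] L s.
  by case: L => // t L _ /(_ t (mem_head _ _))/size0nil -> /size0nil ->; apply: mem_head.
case: s => [|b s] // /andP[covT covF] szL [sz_s].
have cov: covers k [seq behead t | t <- L & head false t == b].
  by case: b; [under eq_filter do rewrite eqb_id | under eq_filter do rewrite eqbF_neg].
have /mapP[t]: s \in [seq behead t | t <- L & head false t == b].
  apply: IHk cov _ sz_s => _ /mapP[t + ->].
  by rewrite mem_filter => /andP[_ /szL]; rewrite size_behead => ->.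
by rewrite mem_filter => /andP[/eqP <- Lt] ->; case: t Lt (szL t Lt).
Qed.

Lemma map_uniq_inj (aT rT : eqType) (f : aT -> rT) s :
  uniq (map f s) -> {in s &, injective f}.
Proof.
move=> Uf x y sx sy fxy; rewrite -(nth_index x sx) -(nth_index x sy); congr nth.
apply/eqP; rewrite -(nth_uniq (f x) _ _ Uf) ?size_map ?index_mem //.
by rewrite !(nth_map x) ?index_mem // !nth_index // fxy.
Qed.

Section CharacterSums.

Variables (gT : finGroupType) (G : {group gT}).
Implicit Type S : {set gT}.

Lemma sum_conj S g (F : gT -> algC) : g \in G -> (forall x, x \in G -> F (x ^ g) = F x) ->
  S \subset G -> (\sum_(x in S :^ g) F x = \sum_(x in S) F x)%R.
Proof.
move=> Gg FJ sSG; rewrite big_imset /=; last by move=> x y _ _ /conjg_inj.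
by apply: eq_bigr => x Sx; rewrite FJ // (subsetP sSG).
Qed.

(** An inverse closed set only sees the real parts of the characters. *)
Lemma char_sum_real S (phi : 'CF(G)) : S^-1 = S ->
  (\sum_(x in S) (phi x + phi (x^-1)%g) = (\sum_(x in S) phi x) *+ 2)%R.
Proof.
move=> SV; rewrite big_split /= GRing.mulr2n; congr (_ + _)%R.
rewrite (reindex_inj invg_inj) /=; apply: eq_big => x; last by rewrite invgK.
by rewrite -mem_invg SV.
Qed.

End CharacterSums.

Section Checks.

Variable T : seq (seq nat).
Local Notation n := (size T).

Definition min_reps (C : seq (seq nat)) k :=
  [seq s <- all_bits k | all (fun cs => lexle s (pull_bits cs s)) C].

Definition orbit_reps (A : seq (seq nat)) :=
  let cl := class_table T in let cr := inv_reps T in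
  let C := [seq class_map cl cr a | a <- A] in
  let R := min_reps C (size cr) in
  (covers (size cr) [seq pull_bits cs r | r <- R, cs <- C], R).

(** The graphs of distinct orbit representatives under automorphisms are told
    apart by their closed walks. *)
Definition CI_check (A : seq (seq nat)) len :=
  let D := quotient_classes T in
  let CR := orbit_reps [seq a <- A | is_tab_aut T a] in
  CR.1 && uniq [seq closed_walks D len r | r <- CR.2].

Definition conj_table g := [seq tab_mul T (tab_mul T (tab_inv T g) i) g | i <- iota 0 n].
Definition conj_tables := [seq conj_table g | g <- iota 0 n].

(** A name for the union of the conjugacy classes of i and of its inverse: the
    smallest of the classes {g, g^-1} contained in it. *)
Definition real_class (cl : seq nat) (A : seq (seq nat)) i :=
  head 0 (sort leq [seq nth 0 cl (nth 0 a i) | a <- A]).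
Definition real_classes :=
  let cl := class_table T in let A := conj_tables in
  [seq real_class cl A i | i <- iota 0 n].
Definition real_class_type (cl ck : seq nat) (s : bitseq) :=
  sort leq (mask (pull_bits cl s) ck).

(** Cospectral connection sets contain equally many elements of each class
    g^G u (g^-1)^G; tested on representatives under conjugation. *)
Definition BI_check len :=
  let D := quotient_classes T in let cl := class_table T in
  let ck := [seq real_class cl conj_tables i | i <- iota 0 n] in
  let CR := orbit_reps conj_tables in
  let P := [seq (closed_walks D len r, real_class_type cl ck r) | r <- CR.2] in
  CR.1 && all (fun p => all (fun q => (p.1 == q.1) ==> (p.2 == q.2)) P) P.

Variables (gT : finGroupType) (G : {group gT}) (e : nat -> gT).
Implicit Types (S U V : {set gT}) (alpha : {perm gT}).
Hypothesis tabT : tabulates T G e.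

Let lt_iota i : i \in iota 0 n -> i < n. Proof. by rewrite mem_iota. Qed.

Lemma nth_class_table i : i < n -> nth 0 (class_table T) i = inv_class T i.
Proof. by move=> lti; rewrite (nth_map 0) ?size_iota // nth_iota. Qed.

Lemma orbit_reps_cover A S : (orbit_reps A).1 -> connection_set G S ->
  exists a r, [/\ a \in A, r \in (orbit_reps A).2, size r = size (inv_reps T)
    & bits_of_set T e S = pull_bits (class_map (class_table T) (inv_reps T) a) r].
Proof.
move=> /coversP cov connS.
have szR r: r \in (orbit_reps A).2 -> size r = size (inv_reps T).
  rewrite /orbit_reps /= mem_filter => /andP[_].
  elim: (size _) r => [|k IHk] r /=; first by rewrite inE => /eqP->.
  by rewrite cats0 mem_cat => /orP[] /mapP[s /IHk <- ->].
have: bits_of_set T e S \in [seq pull_bits cs r | r <- (orbit_reps A).2,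
                       cs <- [seq class_map (class_table T) (inv_reps T) a | a <- A]].
  apply: cov; last exact: size_bits_of_set.
  by move=> _ /allpairsP[[r cs] [_ /mapP[a _ /= ->] ->]]; rewrite !size_map.
case/allpairsP=> [[r _] [/= Rr /mapP[a Aa ->] bS]].
by exists a, r; split; rewrite ?szR.
Qed.

Lemma closed_walks_iso S s len : S \subset G -> cay_iso G S (set_of_bits T G e s) ->
  closed_walks (quotient_classes T) len s = [seq bin_of_nat (walk S l 1) | l <- iota 0 len].
Proof.
move=> sSG isoSs; rewrite (closed_walksE tabT); apply: eq_map => l.
by rewrite (closed_walk_iso l sSG (set_of_bits_sub _ _ _ _) isoSs).
Qed.

(** Two connection sets with isomorphic graphs are moved by automorphisms to
    representatives with as many closed walks, thus to the same one. *)
Lemma CI_checkP A len : CI_check A len -> CI_group G.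
Proof.
case/andP=> cov UR S U connS connU isoSU.
have rep V : connection_set G V -> exists alpha r,
    [/\ alpha \in Aut G, r \in (orbit_reps [seq a <- A | is_tab_aut T a]).2
      & alpha @: V = set_of_bits T G e r].
  move=> connV; have [a [r [+ Rr sz_r bV]]] := orbit_reps_cover cov connV.
  rewrite mem_filter => /andP[aut_a _].
  have [alpha Aalpha aE] := is_tab_autP tabT aut_a.
  have lta i : i < n -> nth 0 a i < n by case/andP: aut_a => bij_a _; apply: nth_tab_bij.
  have connr : connection_set G (alpha^-1 @: set_of_bits T G e r).
    by rewrite connection_set_aut ?groupV // (connection_set_of_bits tabT).
  rewrite im_permV in connr.
  rewrite (bits_of_preim tabT _ aE lta) in bV.
  have ->: V = alpha @^-1: set_of_bits T G e r.
    by rewrite -[LHS](set_of_bitsK tabT) // bV (set_of_bitsK tabT).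
  exists alpha, r; split=> //.
  by rewrite -im_permV -imset_comp (eq_imset _ (permKV _)) imset_id.
have [alpha [r [Aa Rr aS]]] := rep S connS.
have [beta [r' [Ab Rr' bU]]] := rep U connU.
have Er: r = r'.
  have /(_ r r' Rr Rr') inj_r := map_uniq_inj UR.
  have isoS: cay_iso G S (set_of_bits T G e r) by rewrite -aS; apply/aut_iso/connection_sub.
  have isoU: cay_iso G U (set_of_bits T G e r') by rewrite -bU; apply/aut_iso/connection_sub.
  apply: inj_r; rewrite (closed_walks_iso _ (connection_sub connS)) //.
  rewrite (closed_walks_iso _ (connection_sub connU)) //.
  by apply: eq_map => l; rewrite (closed_walk_iso l _ _ isoSU) ?connection_sub.
exists (alpha * beta^-1); first by apply: groupM; rewrite ?groupV.
rewrite (eq_imset _ (permM _ _)) imset_comp aS Er -bU -imset_comp.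
by rewrite (eq_imset _ (permK _)) imset_id.
Qed.

Lemma conj_tableP g i : g < n -> i < n ->
  nth 0 (conj_table g) i < n /\ e (nth 0 (conj_table g) i) = e i ^ e g.
Proof.
move=> ltg lti; rewrite (nth_map 0) ?size_iota // nth_iota // add0n.
have [ltv ev] := tab_invP tabT ltg; case: tabT => _ _ _ opP.
have [lt1 e1] := opP _ _ ltv lti; have [lt2 e2] := opP _ _ lt1 ltg.
by rewrite e2 e1 ev -mulgA.
Qed.

Lemma real_classP i : i < n ->
  exists j g, [/\ j < n, g \in G, e j = e i ^ g
    & real_class (class_table T) conj_tables i = inv_class T j].
Proof.
move=> lti; set ck := real_class _ _ _.
have: ck \in [seq nth 0 (class_table T) (nth 0 a i) | a <- conj_tables].
  rewrite -(mem_sort leq) /ck /real_class.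
  case Es: (sort _ _) => [|k s]; last exact: mem_head.
  move/(congr1 size)/eqP: Es; rewrite size_sort !size_map size_iota.
  by rewrite eqn0Ngt (tab_gt0 tabT).
case/mapP=> _ /mapP[g /lt_iota ltg ->] ->; have [ltj ej] := conj_tableP ltg lti.
exists (nth 0 (conj_table g) i), (e g); split=> //; last by rewrite nth_class_table.
exact: (tab_mem tabT).
Qed.

(** The function [phi x + phi x^-1] is constant on the union of the conjugacy
    classes of x and x^-1, so that its sum depends only on how often a set meets
    each of these unions. *)
Lemma real_class_sum (phi : 'CF(G)) r : size r = size (inv_reps T) ->
  (\sum_(x in set_of_bits T G e r) (phi x + phi (x^-1)%g) =
   \sum_(k <- real_class_type (class_table T) real_classes r)
      (phi (e (nth 0%N (inv_reps T) k)) + phi (e (nth 0%N (inv_reps T) k))^-1%g))%R.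
Proof.
move=> sz_r; rewrite /real_class_type (perm_big _ (permEl (perm_sort _ _))) /=.
rewrite /pull_bits -map_comp.
set p := _ \o _; rewrite -map_mask big_map -filter_mask big_filter.
have [e0 injE defG _] := tabT.
have eG i: i < n -> e i \in G by move=> lti; rewrite defG inE map_f // mem_iota.
transitivity (\sum_(x <- [seq e i | i <- iota 0 n] | x \in set_of_bits T G e r) 
    (phi x + phi (x^-1)%g))%R.
  rewrite [RHS]big_mkcond big_uniq ?(tab_uniq tabT) //= -big_mkcondr.
  apply: eq_bigl => x; apply/idP/andP=> [Rx | []//]; split=> //.
  by move: Rx; rewrite inE defG inE => /andP[].
rewrite big_map [LHS]big_seq_cond [RHS]big_seq_cond; apply: eq_big => [i | i].
  by apply: andb_id2l => /lt_iota lti; rewrite (mem_set_of_bits tabT).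
case/andP=> /lt_iota lti; rewrite (mem_set_of_bits tabT) // => ri.
have [j [g [ltj Gg ej ->]]] := real_classP lti.
have i_gt0: 0 < i.
  by rewrite lt0n; apply: contraTneq ri => ->; rewrite (inv_class0 tabT) nth_default ?sz_r.
have j_gt0: 0 < j.
  rewrite lt0n; apply: contraTneq i_gt0 => j0; rewrite -eqn0Ngt.
  move/eqP: ej; rewrite j0 e0 eq_sym conjg_eq1 -e0 (inj_in_eq injE) ?inE //.
  exact: tab_gt0 tabT.
have [|l [lC ->] el] := inv_classP tabT (i := j); first by rewrite j_gt0.
rewrite nth_index //; have Gei := eG _ lti.
by case: el => ->; rewrite ?invgK ej -conjVg !cfunJ ?groupV // GRing.addrC.
Qed.

(** All characters have equal sums over S and U, which is more than an equality of
    the sets of sums in each degree. *)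
Lemma BI_checkP len : BI_check len -> BI_group G.
Proof.
case/andP=> cov /allP chk S U connS connU isoSU nu _.
have rep V : connection_set G V -> exists2 r,
    r \in (orbit_reps conj_tables).2 /\ size r = size (inv_reps T)
    & exists2 g, g \in G & V :^ g = set_of_bits T G e r.
  move=> connV; have [a [r [+ Rr sz_r bV]]] := orbit_reps_cover cov connV.
  case/mapP=> c /lt_iota ltc Ea.
  have Gg : e c \in G := tab_mem tabT ltc.
  have lta i : i < n -> nth 0 a i < n by move/(conj_tableP ltc)=> []; rewrite -Ea.
  have aE i : i < n -> conjg^~ (e c) (e i) = e (nth 0 a i).
    by move/(conj_tableP ltc)=> [] _; rewrite -Ea.
  exists r => //; exists (e c) => //.
  have preJ (X : {set gT}) : conjg^~ (e c) @^-1: X = X :^ (e c)^-1.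
    by apply/setP=> x; rewrite !inE mem_conjgV.
  rewrite (bits_of_preim tabT (alpha := conjg^~ (e c)) _ aE lta) preJ in bV.
  have connr : connection_set G (set_of_bits T G e r :^ (e c)^-1).
    by rewrite connection_set_conj ?groupV ?(connection_set_of_bits tabT).
  rewrite -[V](set_of_bitsK tabT) // bV (set_of_bitsK tabT) //.
  by rewrite -conjsgM mulVg conjsg1.
have [r [Rr sz_r] [g Gg Sg]] := rep S connS.
have [r' [Rr' sz_r'] [g' Gg' Ug]] := rep U connU.
have isoS: cay_iso G S (set_of_bits T G e r) by rewrite -Sg; apply: conj_iso.
have isoU: cay_iso G U (set_of_bits T G e r') by rewrite -Ug; apply: conj_iso.
have Etype: real_class_type (class_table T) real_classes r =
            real_class_type (class_table T) real_classes r'.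
  have /allP/(_ _ (map_f _ Rr')) := chk _ (map_f _ Rr).
  rewrite (closed_walks_iso _ (connection_sub connS)) //.
  rewrite (closed_walks_iso _ (connection_sub connU)) // => /implyP chk_rr'.
  apply/eqP/chk_rr'/eqP/eq_map=> l.
  by rewrite (closed_walk_iso l _ _ isoSU) ?connection_sub.
suffices EF (phi : 'CF(G)) : (\sum_(s in S) phi s = \sum_(s in U) phi s)%R.
  by move=> x; congr (x \in _); apply: eq_map => i; apply: EF.
have phiJ h : h \in G -> forall x, x \in G -> phi (x ^ h) = phi x.
  by move=> Gh x _; apply: cfunJ.
rewrite -(sum_conj Gg (phiJ g Gg) (connection_sub connS)).
rewrite -(sum_conj Gg' (phiJ g' Gg') (connection_sub connU)).
rewrite Sg Ug; apply: (@Num.Theory.pmulrnI algC 2) => //.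
have RV q : size q = size (inv_reps T) -> (set_of_bits T G e q)^-1 = set_of_bits T G e q.
  by case/(connection_set_of_bits tabT)/andP=> _ /eqP.
by rewrite -!char_sum_real ?RV // !real_class_sum // Etype.
Qed.

End Checks.

(** * Tables from presentations *)

Section Presented.

Variables (n1 n2 m x y z w c : nat).

(** The groups to be examined are generated by commuting elements a1 and a2 of
    orders n1 and n2 and an element b that normalises them:
      b a1 b^-1 = a1^x a2^y,  b a2 b^-1 = a1^z a2^w,  b^m = a1^c.
    Each element is a1^i a2^j b^k for a triple of exponents ((i, j), k). Moving b
    across a1^i a2^j acts linearly on (i, j). *)
Definition conj_exp (p : nat * nat) := (p.1 * x + p.2 * z, p.1 * y + p.2 * w)%N.
Definition exps_mul (p q : nat * nat * nat) :=
  let u := iter p.2 conj_exp q.1 in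
  let k := (p.2 + q.2)%N in
  ((p.1.1 + u.1 + c * (k %/ m)) %% n1, (p.1.2 + u.2) %% n2, k %% m)%N.
Definition exps : seq (nat * nat * nat) :=
  [seq (ij, k) | ij <- [seq (i, j) | i <- iota 0 n1, j <- iota 0 n2], k <- iota 0 m].
Definition table := [seq [seq index (exps_mul p q) exps | q <- exps] | p <- exps].

Definition tab_exp T a k := iter k ((tab_mul T)^~ a) 0.
Definition word_table T a1 a2 b :=
  [seq tab_mul T (tab_mul T (tab_exp T a1 p.1.1) (tab_exp T a2 p.1.2)) (tab_exp T b p.2)
    | p <- exps].
(** An automorphism is determined by the images of the generators, which satisfy
    the same power relations; every such choice of images is listed. *)
Definition candidates T :=
  let I := iota 0 (size T) in
  flatten [seq flatten [seq [seq word_table T a1 a2 b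
    | b <- I & tab_exp T b m == tab_exp T a1 c]
    | a2 <- I & tab_exp T a2 n2 == 0] | a1 <- I & tab_exp T a1 n1 == 0].
Definition CI_presented len := let T := table in CI_check T (candidates T) len.
Definition BI_presented len := let T := table in BI_check T len.

Definition satisfies_relations (gT : finGroupType) (a1 a2 b : gT) :=
  [/\ a1 ^+ n1 = 1, a2 ^+ n2 = 1, b ^+ m = a1 ^+ c
    & [/\ commute a1 a2, b * a1 = a1 ^+ x * a2 ^+ y * b
        & b * a2 = a1 ^+ z * a2 ^+ w * b]].

Variables (gT : finGroupType) (G : {group gT}) (a1 a2 b : gT).
Hypothesis n_gt0 : 0 < n1 * n2 * m.
Hypothesis rel : satisfies_relations a1 a2 b.

Definition word (p : nat * nat * nat) := a1 ^+ p.1.1 * a2 ^+ p.1.2 * b ^+ p.2.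

Lemma mem_exps p : (p \in exps) = [&& p.1.1 < n1, p.1.2 < n2 & p.2 < m].
Proof.
case: p => [[i j] k] /=; apply/allpairsP/and3P.
  case=> [[ij k']] /= [/allpairsP[[i' j'] /= [+ + ->] + [-> -> ->]]].
  by rewrite !mem_iota.
move=> [lti ltj ltk]; exists ((i, j), k); rewrite mem_iota; split=> //.
by apply/allpairsP; exists (i, j); rewrite !mem_iota.
Qed.

Lemma size_exps : size exps = (n1 * n2 * m)%N.
Proof. by rewrite !size_allpairs !size_iota. Qed.

Lemma size_table : size table = (n1 * n2 * m)%N.
Proof. by rewrite size_map size_exps. Qed.

Lemma exps_mul_in p q : exps_mul p q \in exps.
Proof.
move: n_gt0; rewrite !muln_gt0 => /andP[/andP[n1_gt0 n2_gt0] m_gt0].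
by rewrite mem_exps /= !ltn_mod n1_gt0 n2_gt0 m_gt0.
Qed.

Lemma conj_exp_word p :
  b * (a1 ^+ p.1 * a2 ^+ p.2) = a1 ^+ (conj_exp p).1 * a2 ^+ (conj_exp p).2 * b.
Proof.
case: rel => _ _ _ [cmm ba1 ba2]; case: p => i j /=.
have conj_b g h : b * g = h * b -> g ^ b^-1 = h.
  by move=> bg; rewrite conjgE invgK mulgA bg mulgK.
have c1 k l : commute (a1 ^+ k) (a2 ^+ l) by apply/commuteX2.
have: (a1 ^+ i * a2 ^+ j) ^ b^-1 = (a1 ^+ x * a2 ^+ y) ^+ i * (a1 ^+ z * a2 ^+ w) ^+ j.
  by rewrite conjMg !conjXg (conj_b _ _ ba1) (conj_b _ _ ba2).
rewrite !expgMn // -!expgM => /(canRL (conjgKV _)) ->.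
rewrite conjgE mulgA mulgV mul1g; congr (_ * _).
rewrite !expgD ![(_ * i)%N]mulnC ![(_ * j)%N]mulnC -!mulgA; congr (_ * _).
by rewrite !mulgA; congr (_ * _); apply/esym/c1.
Qed.

Lemma iter_conj_exp_word k p : b ^+ k * (a1 ^+ p.1 * a2 ^+ p.2) =
  a1 ^+ (iter k conj_exp p).1 * a2 ^+ (iter k conj_exp p).2 * b ^+ k.
Proof.
elim: k => [|k IHk]; first by rewrite mulg1 mul1g.
by rewrite expgS -mulgA IHk mulgA conj_exp_word -mulgA -expgS.
Qed.

(** Collection: b^k is moved across the second word, the powers of a1 and a2 are
    merged, and m-th powers of b are traded for c-th powers of a1. *)
Lemma wordM p q : word (exps_mul p q) = word p * word q.
Proof.
case: rel => a1n a2n bm [cmm _ _]; rewrite /word /exps_mul /=.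
set u := iter _ _ _; rewrite (expg_mod _ a1n) (expg_mod _ a2n).
have cX k l : commute (a1 ^+ k) (a2 ^+ l) by apply/commuteX2.
transitivity (a1 ^+ p.1.1 * a2 ^+ p.1.2 * (a1 ^+ u.1 * a2 ^+ u.2) * b ^+ (p.2 + q.2)).
  have ->: b ^+ (p.2 + q.2) =
      a1 ^+ (c * ((p.2 + q.2) %/ m)) * b ^+ ((p.2 + q.2) %% m).
    by rewrite {1}(divn_eq (p.2 + q.2) m) expgD mulnC !expgM bm.
  have cXA k l h : a2 ^+ l * (a1 ^+ k * h) = a1 ^+ k * (a2 ^+ l * h).
    by rewrite !mulgA cX.
  by rewrite !expgD -!mulgA !cXA.
rewrite expgD !mulgA; congr (_ * _).
by rewrite -!mulgA; congr (_ * (_ * _)); rewrite iter_conj_exp_word mulgA.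
Qed.

Definition tab_word t := word (nth (0, 0, 0) exps t).

Hypothesis genG : G :=: <<[set a1; a2; b]>>.
Hypothesis cardG : #|G| = (n1 * n2 * m)%N.

(** The words are closed under product, so that they exhaust G; as many as the
    order of G, they are pairwise distinct. *)
Lemma tabulates_presented : tabulates table G tab_word.
Proof.
move: (n_gt0); rewrite !muln_gt0 => /andP[/andP[n1_gt0 n2_gt0] m_gt0].
have opE i j : i < size table -> j < size table ->
    tab_mul table i j < size table /\ tab_word (tab_mul table i j) = tab_word i * tab_word j.
  rewrite size_table -size_exps => lti ltj.
  rewrite /tab_mul (nth_map (0, 0, 0)) // (nth_map (0, 0, 0)) //.
  by rewrite index_mem exps_mul_in /tab_word nth_index ?exps_mul_in // wordM.
pose K := [set:: [seq tab_word i | i <- iota 0 (size table)]].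
have wordK p : p \in exps -> word p \in K.
  move=> Cp; rewrite inE; apply/mapP; exists (index p exps).
    by rewrite mem_iota size_table -size_exps index_mem.
  by rewrite /tab_word nth_index.
have modK i j k : word (i %% n1, j %% n2, k %% m)%N \in K.
  by rewrite wordK // mem_exps /= !ltn_mod n1_gt0 n2_gt0.
have [a1n a2n bm [_ _ _]] := rel.
have gK : group_set K.
  apply/group_setP; split; first by have := modK 0 0 0; rewrite !mod0n /word !mulg1.
  move=> g h; rewrite !inE => /mapP[i + ->] /mapP[j + ->]; rewrite !mem_iota => lti ltj.
  have [lto <-] := opE i j lti ltj.
  by rewrite map_f // mem_iota.
have sGK : G \subset K.
  rewrite genG (gen_subG _ (group gK)) !subUset !sub1set -!andbA; apply/and3P; split.
  - by have := modK 1%N 0 0; rewrite !mod0n /word /= (expg_mod _ a1n) !mulg1.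
  - by have := modK 0 1%N 0; rewrite !mod0n /word /= (expg_mod _ a2n) mulg1 mul1g.
  have [m1 | m_gt1] := leqP m 1.
    have -> : b = a1 ^+ c by rewrite -bm (_ : m = 1%N) //; apply/eqP; rewrite eqn_leq m1.
    by have := modK c 0 0; rewrite !mod0n /word /= (expg_mod _ a1n) !mulg1.
  by have := modK 0 0 1%N; rewrite !mod0n /word /= modn_small // !mul1g.
have cardK : #|K| <= size table.
  by rewrite cardsE (leq_trans (card_size _)) // size_map size_iota.
have defG : G :=: K.
  by apply/eqP; rewrite eqEcard sGK cardG -size_table.
have Uelt : uniq [seq tab_word i | i <- iota 0 (size table)].
  by apply/card_uniqP; rewrite -cardsE -/K -defG cardG size_map size_iota size_table.
split=> //.
- rewrite /tab_word; have ->: nth (0, 0, 0) exps 0 = (0, 0, 0); last by rewrite /word !mulg1.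
  by rewrite /exps; case: (n1) n1_gt0; case: (n2) n2_gt0; case: (m) m_gt0.
move=> i j lti ltj eij; apply/eqP.
have nthE k : k < size table ->
    nth (tab_word 0) [seq tab_word i | i <- iota 0 (size table)] k = tab_word k.
  by move=> ltk; rewrite (nth_map 0) ?size_iota // nth_iota.
rewrite -(nth_uniq (tab_word 0) _ _ Uelt) ?nthE ?eij //.
  by rewrite size_map size_iota.
by rewrite size_map size_iota.
Qed.

Lemma tab_expP a k : a < size table ->
  tab_exp table a k < size table /\ tab_word (tab_exp table a k) = tab_word a ^+ k.
Proof.
have [e0 _ _ opP] := tabulates_presented => lta.
elim: k => [|k [ltk ek]] /=; first by rewrite e0 (tab_gt0 tabulates_presented).
by have [lto ->] := opP _ _ ltk lta; rewrite ek expgSr.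
Qed.

(** The search of the candidates is exhaustive, so that it can also show that no
    automorphism has a given property. *)
Lemma aut_candidate alpha : alpha \in Aut G -> exists2 a, a \in candidates table
  & forall i, i < size table ->
      nth 0 a i < size table /\ alpha (tab_word i) = tab_word (nth 0 a i).
Proof.
move=> Aa; have tabT := tabulates_presented; have [e0 injE _ opP] := tabT.
have cmP g : g \in G -> tab_code table tab_word (alpha g) < size table
    /\ tab_word (tab_code table tab_word (alpha g)) = alpha g.
  by move=> Gg; apply: (tab_codeP tabT); rewrite Aut_closed.
have [Ga1 Ga2 Gb] : [/\ a1 \in G, a2 \in G & b \in G].
  by rewrite genG; split; apply: mem_gen; rewrite !inE eqxx ?orbT.
have [lt1 e1] := cmP _ Ga1; have [lt2 e2] := cmP _ Ga2; have [ltb eb] := cmP _ Gb.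
have aX g k : g \in G -> alpha (g ^+ k) = alpha g ^+ k.
  by move=> Gg; rewrite -(autmE Aa) morphX.
have aM g h : g \in G -> h \in G -> alpha (g * h) = alpha g * alpha h.
  by move=> Gg Gh; rewrite -(autmE Aa) morphM.
have [a1n a2n bm _] := rel.
set A := tab_code _ _ _ in lt1 e1; set B := tab_code _ _ _ in lt2 e2.
set C := tab_code _ _ _ in ltb eb.
exists (word_table table A B C).
  apply/flatten_mapP; exists A.
    rewrite mem_filter mem_iota /= lt1 andbT; have [ltp ep] := tab_expP n1 lt1.
    apply/eqP; apply: injE; rewrite ?inE ?(tab_gt0 tabT) // ep e0 e1 -aX // a1n.
    by rewrite -(autmE Aa) morph1.
  apply/flatten_mapP; exists B.
    rewrite mem_filter mem_iota /= lt2 andbT; have [ltp ep] := tab_expP n2 lt2.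
    apply/eqP; apply: injE; rewrite ?inE ?(tab_gt0 tabT) // ep e0 e2 -aX // a2n.
    by rewrite -(autmE Aa) morph1.
  apply: map_f; rewrite mem_filter mem_iota /= ltb andbT.
  have [ltp ep] := tab_expP m ltb; have [ltq eq] := tab_expP c lt1.
  by apply/eqP; apply: injE; rewrite ?inE // ep eq eb e1 -!aX // bm.
move=> i; rewrite size_table -size_exps => lti; rewrite size_exps -size_table.
rewrite (nth_map (0, 0, 0)) //; set p := nth _ _ _.
have [l1 E1] := tab_expP p.1.1 lt1; have [l2 E2] := tab_expP p.1.2 lt2.
have [l3 E3] := tab_expP p.2 ltb.
have [l12 E12] := opP _ _ l1 l2; have [l123 E123] := opP _ _ l12 l3.
split=> //; rewrite E123 E12 E1 E2 E3 e1 e2 eb -!aX // -!aM ?groupM ?groupX //.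
Qed.

Definition bits_of_exps (l : seq (nat * nat * nat)) :=
  [seq nth (0, 0, 0) exps r \in l | r <- inv_reps table].

(** [phi] acts on triples of exponents; [ls] and [lt] list the exponents of the
    elements of two connection sets. *)
Definition nonCI_presented (phi : nat * nat * nat -> nat * nat * nat)
    (ls lt : seq (nat * nat * nat)) :=
  let T := table in let cl := class_table T in let cr := inv_reps T in
  let s := bits_of_exps ls in let t := bits_of_exps lt in
  is_tab_iso T [seq index (phi p) exps | p <- exps] s t &&
  all (fun a => pull_bits (class_map cl cr a) t != s) (candidates T).

Lemma nonCI_presentedP phi ls lt : nonCI_presented phi ls lt -> ~ CI_group G.
Proof.
have tabT := tabulates_presented.
case/andP=> /(is_tab_isoP tabT) iso_st /allP noaut CIG.
set s := bits_of_exps ls in iso_st noaut; set t := bits_of_exps lt in iso_st noaut.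
have conn q : size q = size (inv_reps table) ->
    connection_set G (set_of_bits table G tab_word q).
  exact: connection_set_of_bits.
have [||alpha Aa aS] := CIG _ _ _ _ iso_st; try by apply: conn; rewrite size_map.
have [a Ca aE] := aut_candidate Aa.
have lta i : i < size table -> nth 0 a i < size table by case/aE.
have aeE i : i < size table -> alpha (tab_word i) = tab_word (nth 0 a i) by case/aE.
case/negP: (noaut a Ca); rewrite (bits_of_preim tabT _ aeE lta) -aS.
rewrite -im_permV -imset_comp (eq_imset _ (permK _)) imset_id.
by rewrite (bits_of_setK tabT) // size_map.
Qed.

End Presented.

(** The order is part of the definition, for the relations alone only bound it
    from above. *)
Definition has_presentation n1 n2 m x y z w c (gT : finGroupType) (G : {group gT}) :=
  #|G| = (n1 * n2 * m)%N /\ exists a1 a2 b : gT,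
    [/\ satisfies_relations n1 n2 m x y z w c a1 a2 b,
        [/\ a1 \in G, a2 \in G & b \in G] & G \subset <<[set a1; a2; b]>>].

Lemma has_presentationP n1 n2 m x y z w c (gT : finGroupType) (G : {group gT}) :
  has_presentation n1 n2 m x y z w c G -> exists a1 a2 b,
    [/\ 0 < n1 * n2 * m, satisfies_relations n1 n2 m x y z w c a1 a2 b,
        G :=: <<[set a1; a2; b]>> & #|G| = (n1 * n2 * m)%N].
Proof.
move=> [cardG [a1 [a2 [b [rel [Ga1 Ga2 Gb] sGK]]]]]; exists a1, a2, b.
split=> //; first by rewrite -cardG.
by apply/eqP; rewrite eqEsubset sGK gen_subG !subUset !sub1set Ga1 Ga2 Gb.
Qed.

Lemma CI_of_presentation n1 n2 m x y z w c len (gT : finGroupType) (G : {group gT}) :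
  has_presentation n1 n2 m x y z w c G -> CI_presented n1 n2 m x y z w c len ->
  CI_group G.
Proof.
case/has_presentationP=> a1 [a2 [b [n_gt0 rel genG cardG]]].
exact: (CI_checkP (tabulates_presented n_gt0 rel genG cardG)).
Qed.

Lemma BI_of_presentation n1 n2 m x y z w c len (gT : finGroupType) (G : {group gT}) :
  has_presentation n1 n2 m x y z w c G -> BI_presented n1 n2 m x y z w c len ->
  BI_group G.
Proof.
case/has_presentationP=> a1 [a2 [b [n_gt0 rel genG cardG]]].
exact: (BI_checkP (tabulates_presented n_gt0 rel genG cardG)).
Qed.

(** * Small non-abelian BI-groups *)

Section SmallGroups.

Variables (gT : finGroupType) (G : {group gT}).
Implicit Types (K P Q V A B : {group gT}) (a b c d g h u v s t : gT).

Lemma sub_coprime_card A B K : A \subset K -> B \subset K -> coprime #|A| #|B| ->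
  #|G| = (#|A| * #|B|)%N -> K \subset G -> G :=: K.
Proof.
move=> sAK sBK coAB oG sKG; apply/eqP; rewrite eq_sym eqEcard sKG oG.
by rewrite dvdn_leq // Gauss_dvd // !cardSg.
Qed.

Lemma cent_inverted g b p : odd p -> g ^+ p = 1 -> g ^ b = g -> g ^ b = g^-1 -> g = 1.
Proof.
move=> odd_p gp -> /eqP; rewrite eq_sym eq_invg_mul => /eqP g2.
move: gp; rewrite -[p]odd_double_half odd_p add1n expgS -mul2n expgM.
by rewrite expgS expg1 g2 expg1n mulg1.
Qed.

(** Throughout, b is an involution that acts on an abelian normal subgroup P of
    odd order q and index 2. *)
Section Dihedral.

Variables (q : nat) (P : {group gT}) (b : gT).
Hypotheses (odd_q : odd q) (oG : #|G| = (q * 2)%N) (oP : #|P| = q).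
Hypotheses (sPG : P \subset G) (cPP : abelian P) (Gb : b \in G) (ob : #[b] = 2).

Let nsPG : P <| G.
Proof.
by apply: index2_normal; rewrite // -divgS // oG oP mulKn // odd_gt0.
Qed.

Let defG : G :=: P <*> <[b]>.
Proof.
apply: (@sub_coprime_card P <[b]>%G); rewrite ?joing_subl ?joing_subr //=.
- by rewrite oP -orderE ob coprimen2.
- by rewrite oG oP -orderE ob.
by rewrite join_subG sPG cycle_subG.
Qed.

Let PJ x : x \in P -> x ^ b \in P.
Proof. by move=> Px; rewrite memJ_norm // (subsetP (normal_norm nsPG)). Qed.

Let b2 : b * b = 1.
Proof. by rewrite -[b * b]/(b ^+ 2) -ob expg_order. Qed.

Let bV : b^-1 = b.
Proof. by apply/eqP; rewrite eq_invg_mul b2. Qed.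

Let bK x : (x ^ b) ^ b = x.
Proof. by rewrite -conjgM b2 conjg1. Qed.

Let b_mul x : b * x = x ^ b * b.
Proof. by rewrite conjgE bV -!mulgA b2 mulg1. Qed.

Let nab_move : ~~ abelian G -> exists2 x, x \in P & x ^ b != x.
Proof.
rewrite defG abelianY cPP cycle_abelian /= cycle_subG => /centP nab.
apply/exists_inP; apply: contra_notT nab => /exists_inPn fix_b x Px.
by have /negPn/eqP := fix_b x Px; move/conjg_fixP/commgP.
Qed.

(** The involution maps a generator a of P to a^i with i^2 = 1 modulo q. For q an
    odd prime power this leaves i = 1, which makes G abelian, and i = -1. *)
Lemma dihedral_presentation : ~~ abelian G -> cyclic P ->
    (forall i, i < q -> (i * i = 1 %[mod q])%N -> i = 1%N \/ i = q.-1) ->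
  has_presentation q 1 2 q.-1 0 0 0 0 G.
Proof.
move=> nab /cyclicP[a defP] sqrt1.
have Pa : a \in P by rewrite defP cycle_id.
have oa : #[a] = q by rewrite orderE -defP.
have q_gt0 := odd_gt0 odd_q.
have /cyclePmin[i lti ab]: a ^ b \in <[a]> by rewrite -defP PJ.
rewrite oa in lti.
have [x Px xb] := nab_move nab.
have {x Px xb} ab_neq : i <> 1%N.
  move=> i1; case/negP: xb; move: Px; rewrite defP => /cycleP[k ->].
  by rewrite conjXg ab i1 expg1.
have ab' : a ^ b = a^-1.
  have [|/ab_neq//|iq] := sqrt1 i lti.
    by apply/eqP; rewrite -oa -eq_expg_mod_order expgM -ab -conjXg -ab bK.
  by apply/eqP; rewrite ab iq eq_sym eq_invg_mul -expgS prednK // -oa expg_order.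
have baE : b * a = a ^+ q.-1 * b.
  rewrite b_mul ab'; congr (_ * _); apply/eqP.
  by rewrite eq_invg_mul -expgS prednK // -oa expg_order.
split; first by rewrite muln1.
exists a, 1, b; split.
- split; rewrite ?expg1n //; first by rewrite -oa expg_order.
  by split; rewrite ?mulg1 ?mul1g //; apply: commute1.
- by split=> //; apply: (subsetP sPG).
- by rewrite defG join_subG defP !cycle_subG !mem_gen // !inE eqxx ?orbT.
Qed.

(** If b fixed some c <> 1, then <c> would be normal, hence also <cd> for an
    element d <> 1 inverted by b; but then the conjugate c d^-1 of c d would lie in
    <cd>, which forces <c> = <cd>. So x x^b, being fixed by b, is trivial. *)
Lemma BI_elementary_inverted : BI_group G -> ~~ abelian G ->
    {in P, forall x, x ^+ 3 = 1} -> {in P, forall x, x ^ b = x^-1}.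
Proof.
move=> BI nab exp3; have [y Py yb] := nab_move nab.
have inv1 x : x \in P -> x ^ b = x -> x ^ b = x^-1 -> x = 1.
  by move=> Px; apply: (@cent_inverted x b 3); rewrite ?exp3.
have ord3 x : x \in P -> x != 1 -> #[x] = 3.
  by move=> Px ntx; apply: nt_prime_order; rewrite ?exp3.
pose d := y^-1 * y ^ b.
have Pd : d \in P by rewrite groupM ?groupV ?PJ.
have db : d ^ b = d^-1.
  by rewrite /d [RHS]invMg invgK conjMg conjVg bK.
have ntd : d != 1 by rewrite -eq_mulVg1 eq_sym.
have fix1 c : c \in P -> c ^ b = c -> c = 1.
  move=> Pc cb; apply/eqP/negPn/negP=> ntc.
  have nsc : <[c]> <| G.
    rewrite /normal cycle_subG (subsetP sPG) //= cents_norm // cent_cycle defG.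
    rewrite join_subG cycle_subG sub_cent1 (subsetP cPP) //=.
    by apply/cent1P; rewrite /commute b_mul cb.
  have ntcd : c * d != 1.
    apply: contraNneq ntd => cd1.
    have Ed : d = c^-1 by apply/eqP; rewrite eq_sym eq_invg_mul cd1.
    by apply/eqP/inv1 => //; rewrite Ed conjVg cb.
  have Pcd : c * d \in P by rewrite groupM.
  have nscd : <[c * d]> <| G.
    apply: (BI_normal BI nsc); first by rewrite cycle_subG (subsetP sPG).
    by rewrite -!orderE !ord3.
  have cd'_in : c * d^-1 \in <[c * d]>.
    rewrite -{1}cb -db -conjMg memJ_norm ?cycle_id //.
    by rewrite (subsetP (normal_norm nscd)).
  have c_in : c \in <[c * d]>.
    have c2 : c * d * (c * d^-1) = c ^+ 2.
      by rewrite mulgA -(mulgA c) (centsP cPP d Pd c Pc) mulgA mulgK.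
    have Ec : c = (c ^+ 2) ^+ 2 by rewrite -expgM expgS exp3 ?mulg1.
    by rewrite [X in X \in _]Ec -c2 groupX // groupM ?cycle_id.
  have d_in : d \in <[c]>.
    have Ecd : <[c]> = <[c * d]>.
      by apply/eqP; rewrite eqEcard cycle_subG c_in -!orderE !ord3.
    by rewrite -(groupMl d (cycle_id c)) /= Ecd cycle_id.
  case/eqP: ntd; apply: inv1 => //; case/cycleP: d_in => k ->.
  by rewrite conjXg cb.
move=> x Px; apply/eqP; rewrite eq_sym eq_invg_mul; apply/eqP/fix1.
  by rewrite groupM ?PJ.
by rewrite conjMg bK; apply: (centsP cPP); rewrite ?PJ.
Qed.

Lemma elementary_presentation : BI_group G -> ~~ abelian G -> q = 9 ->
    {in P, forall x, x ^+ 3 = 1} ->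
  has_presentation 3 3 2 2 0 0 2 0 G.
Proof.
move=> BI nab q9 exp3; have Pb := BI_elementary_inverted BI nab exp3.
have ord3 x : x \in P -> x != 1 -> #[x] = 3.
  by move=> Px ntx; apply: nt_prime_order; rewrite ?exp3.
have /trivgPn[a1 Pa1 nta1] : P :!=: 1 by rewrite -cardG_gt1 oP q9.
have : ~~ (P \subset <[a1]>).
  by apply: contraL isT => /subset_leq_card; rewrite -orderE ord3 // oP q9.
case/subsetPn=> a2 Pa2 a2a1.
have nta2 : a2 != 1 by apply: contraNneq a2a1 => ->.
have sqrV x : x \in P -> x^-1 = x ^+ 2.
  by move=> Px; apply/eqP; rewrite eq_invg_mul -expgS exp3.
split; first by rewrite oG q9.
exists a1, a2, b; split.
  split; rewrite ?exp3 //; split; first exact: (centsP cPP).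
    by rewrite b_mul Pb // sqrV // mulg1.
  by rewrite b_mul Pb // sqrV // mul1g.
  by split=> //; apply: (subsetP sPG).
set K := <<_>>.
have [Ka1 Ka2 Kb] : [/\ a1 \in K, a2 \in K & b \in K].
  by split; apply: mem_gen; rewrite !inE eqxx ?orbT.
suffices sPK : P \subset K by rewrite defG join_subG sPK cycle_subG.
have s1 : <[a1]> \subset P :&: K by rewrite cycle_subG inE Pa1.
have : #|P :&: K| %| (3 ^ 2)%N by rewrite -[(3 ^ 2)%N]/9 -q9 -oP cardSg ?subsetIl.
case/dvdn_pfactor=> // k le_k2 oPK.
have lt3 : 3 < #|P :&: K|.
  rewrite -(ord3 a1) // orderE proper_card // properE s1 /=.
  by apply/negP=> /subsetP/(_ a2); rewrite inE Pa2 (negbTE a2a1) => /(_ Ka2).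
apply/setIidPl/eqP; rewrite eqEcard subsetIl oP q9 oPK /=.
by case: k le_k2 oPK lt3 => [|[|[|k]]] // _ ->.
Qed.

End Dihedral.

(** By [BI_der1] the derived subgroup G' is the only subgroup of its order. It has
    order 2 or 4, as G / G' is not cyclic. In the first case every involution
    generates G'. In the second, G' = <h> is generated by any element of order 4,
    and an involution u other than h^2 would span with h^2 another subgroup of
    order 4. *)
Lemma BI_unique_involution n : BI_group G -> ~~ abelian G -> #|G| = (2 ^ n)%N ->
  n <= 4 -> exists2 z, z \in G & forall u, u \in G -> #[u] = 2 -> u = z.
Proof.
move=> BI nab oG le_n4.
have pG : 2.-group G by rewrite /pgroup oG pnatX.
have nG' B : B \subset G -> #|B| = #|G^`(1)| -> B :=: G^`(1).
  move=> sBG oB; apply/esym/eqP; rewrite eqEcard oB leqnn andbT.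
  by apply: (BI_der1 BI (subxx _)) => //; apply: der_sub.
have [k oG'] := p_natP (pgroupS (der_sub 1 G) pG).
have k_gt0 : 0 < k.
  rewrite lt0n; apply: contra nab => /eqP k0; apply/derG1P.
  by apply: card_le1_trivg; rewrite oG' k0.
have lt_k : k.+1 < n.
  rewrite ltnNge; apply: contra nab => le_nk; apply: cyclic_abelian.
  apply: cyclic_nilpotent_quo_der1_cyclic (pgroup_nil pG) _.
  have oQ : #|G / G^`(1)| <= 2.
    rewrite card_quotient ?der_norm // -(leq_pmul2l (cardG_gt0 G^`(1))).
    by rewrite Lagrange ?der_sub // oG oG' -expnSr leq_exp2l.
  case: (ltngtP #|G / G^`(1)| 2) oQ => // [lt2 _ | o2 _]; last by rewrite prime_cyclic // o2.
  by rewrite (card_le1_trivg (lt2 : _ <= 1)) cyclic1.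
have k12 : (k == 1%N) || (k == 2).
  by case: (k) k_gt0 lt_k => [|[|[|j]]] // _; case: (n) le_n4 => [|[|[|[|[|]]]]].
case/orP: k12 => /eqP Ek.
  have /cyclicP[z defG'] : cyclic G^`(1) by rewrite prime_cyclic // oG' Ek.
  exists z => [|u Gu ou]; first by rewrite (subsetP (der_sub 1 G)) // defG' cycle_id.
  have : u \in <[z]>.
    by rewrite -defG' -(nG' <[u]>%G) ?cycle_id ?cycle_subG //= -orderE ou oG' Ek.
  have oz : #[z] = 2 by rewrite orderE -defG' oG' Ek.
  rewrite cycle2g // !inE => /orP[] /eqP // u1.
  by rewrite u1 order1 in ou.
have [g Gg g2] : exists2 g, g \in G & g ^+ 2 != 1.
  apply/exists_inP; apply: contraR nab => /exists_inPn sq1.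
  have invE x : x \in G -> x^-1 = x.
    by move=> Gx; apply/eqP; rewrite eq_invg_mul; apply/negPn/(sq1 x Gx).
  apply/centsP=> x Gx y Gy; rewrite /commute.
  by rewrite -[x * y]invE ?groupM // invMg !invE.
have [h Gh oh] : exists2 h, h \in G & #[h] = 4.
  have [j og] := p_natP (mem_p_elt pG Gg).
  have j_gt1 : 1 < j.
    rewrite ltnNge; apply: contra g2 => le_j1.
    by rewrite -order_dvdn og -[2]/(2 ^ 1)%N dvdn_exp2l.
  exists (g ^+ (2 ^ (j - 2))); first by rewrite groupX.
  by rewrite orderXdiv og ?dvdn_exp2l ?leq_subr // -expnB ?leq_subr // subKn.
have defG' : G^`(1) = <[h]>.
  by rewrite -(nG' <[h]>%G) ?cycle_subG //= -orderE oh oG' Ek.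
have oh2 : #[h ^+ 2] = 2 by rewrite orderXdiv oh.
have uniq_h v : v \in <[h]> -> #[v] = 2 -> v = h ^+ 2.
  move=> hv ov; have : <[v]> == <[h ^+ 2]>.
    rewrite (eq_subG_cyclic (cycle_cyclic h)) ?cycle_subG ?groupX ?cycle_id //.
    by rewrite -!orderE ov oh2.
  move/eqP=> Evh; have : v \in <[h ^+ 2]> by rewrite -Evh cycle_id.
  rewrite cycle2g // !inE => /orP[] /eqP // v1.
  by rewrite v1 order1 in ov.
exists (h ^+ 2) => [|u Gu ou]; first by rewrite groupX.
apply/eqP/negPn/negP => neq_uh; case/negP: (neq_uh); apply/eqP/uniq_h => //.
have cuh : h ^+ 2 \in 'C[u].
  apply/cent1P/commgP/conjg_fixP; apply: uniq_h; last by rewrite orderJ.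
  by rewrite -defG' memJ_norm ?(subsetP (der_norm 1 G)) // defG' groupX ?cycle_id.
have oB : #|<[u]> <*> <[h ^+ 2]>| = 4.
  rewrite cent_joinEr; last by rewrite /= -cent_cycle -cycle_subG in cuh *.
  rewrite TI_cardMg /= -?orderE ?ou ?oh2 // prime_TIg /= -?orderE ?ou //.
  by rewrite cycle_subG /= cycle2g // !inE negb_or neq_uh andbT -order_eq1 ou.
by rewrite -defG' -(nG' (<[u]> <*> <[h ^+ 2]>)%G) ?mem_gen ?inE ?cycle_id //=
  ?oG' ?Ek // join_subG !cycle_subG groupX ?andbT.
Qed.

(** A non-cyclic 2-group with a unique involution is generalised quaternion. Order
    16 is impossible: there G' is cyclic of order 4 but not the only such
    subgroup. *)
Lemma quaternion_presentation n : BI_group G -> ~~ abelian G -> #|G| = (2 ^ n)%N ->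
  n <= 4 -> has_presentation 4 1 2 3 0 0 0 2 G.
Proof.
move=> BI nab oG le_n4.
have pG : 2.-group G by rewrite /pgroup oG pnatX.
have ntG : G :!=: 1 by apply: contraNneq nab => ->; apply: abelian1.
have [z Gz uniq_z] := BI_unique_involution BI nab oG le_n4.
have oz : #[z] = 2.
  have [u Gu ou] := Cauchy (isT : prime 2) (let: And3 _ d _ := pgroup_pdiv pG ntG in d).
  by rewrite -(uniq_z u).
(* The subgroup generated by the involutions has order 2. *)
have /(prime_Ohm1P pG ntG) : #|'Ohm_1(G)| = 2.
  rewrite Ohm1Eprime (_ : [set x in G | prime #[x]] = [set z]) -?orderE //.
  apply/setP=> x; rewrite !inE; apply/andP/eqP=> [[Gx px] | ->]; last by rewrite oz.
  by apply: uniq_z => //; have := mem_p_elt pG Gx; rewrite /p_elt pnatE // inE => /eqP.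
case/orP=> [/cyclic_abelian cGG | ]; first by rewrite cGG in nab.
case/andP=> _ /eqP/quaternion_classP[r r_gt2 isoG].
have Ern : r = n.
  apply/eqP; rewrite -(eqn_exp2l r n (isT : 1 < 2)) -oG.
  by rewrite (card_isog isoG) card_quaternion.
rewrite {r}Ern in r_gt2 isoG.
have [[x y] genG [oy y2 xy]] := generators_quaternion r_gt2 isoG.
have [_ Gx ox /setDP[Gy Xy]] := genG.
have [n3 | n_neq3] := eqVneq n 3; last first.
  have [_ [defG' _ oG' _] _ _ _] := quaternion_structure r_gt2 genG isoG.
  have n4 : n = 4 by apply/eqP; rewrite eqn_leq le_n4 ltn_neqAle eq_sym n_neq3.
  rewrite n4 /= -[(2 ^ 2)%N]/4 in oG'.
  have sG'y : G^`(1) \subset <[y]>.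
    by apply: (BI_der1 BI (subxx _)); rewrite ?der_sub ?cycle_subG // oG' -orderE oy.
  case/negP: Xy; rewrite -cycle_subG.
  have <- : G^`(1) = <[y]> by apply/eqP; rewrite eqEcard sG'y oG' -orderE oy.
  by rewrite defG' cycle_subG mem_cycle.
have [_ _ _ defG _] := extremal_generators_facts (isT : prime 2) genG.
rewrite n3 /= in oG ox y2.
have x4 : x ^+ 4 = 1 by rewrite -[4]/(2 ^ 2)%N -ox expg_order.
have xV : x^-1 = x ^+ 3 by apply/eqP; rewrite eq_invg_mul -expgS x4.
split; first by rewrite oG.
exists x, 1, y; split.
- split; rewrite ?expg1n //; split; first exact: commute1.
    by rewrite mulg1 -xV [RHS]conjgC conjVg xy invgK.
  by rewrite mulg1 !mul1g.
- by split.
by rewrite -defG mul_subG // cycle_subG mem_gen // !inE eqxx ?orbT.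
Qed.

(** Some s in a Sylow 2-subgroup V inverts a. If s had order 2, V would contain a
    central involution z; with <z> normal, [BI_normal] would make <s> normal, so s
    would centralise a. This excludes the dihedral group. *)
Lemma dicyclic_presentation a : BI_group G -> ~~ abelian G -> #|G| = 12 ->
  <[a]> <| G -> #[a] = 3 -> has_presentation 3 1 4 2 0 0 0 0 G.
Proof.
move=> BI nab oG nsaG oa; have Ga : a \in G by rewrite -cycle_subG normal_sub.
have a3 : a ^+ 3 = 1 by rewrite -oa expg_order.
have nta : a != 1 by rewrite -order_gt1 oa.
have [V sylV] := Sylow_exists 2 G; have [sVG _ _] := and3P sylV.
have oV : #|V| = 4 by rewrite (card_Hall sylV) oG p_part.
have cVV : abelian V by apply: (card_p2group_abelian (isT : prime 2)).
have defG : G :=: <[a]> <*> V.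
  apply: (@sub_coprime_card <[a]>%G V); rewrite ?joing_subl ?joing_subr //=.
  - by rewrite -orderE oa oV.
  - by rewrite -orderE oa oV.
  by rewrite join_subG cycle_subG Ga.
have aJ v : v \in V -> a ^ v = a \/ a ^ v = a^-1.
  move=> Vv; have /cyclePmin[i] : a ^ v \in <[a]>.
    by rewrite memJ_norm ?cycle_id // (subsetP (normal_norm nsaG)) // (subsetP sVG).
  rewrite oa; case: i => [|[|[|]]] // _ Eav.
  - by case/eqP: nta; apply/eqP; rewrite -(conjg_eq1 a v) Eav.
  - by left.
  by right; apply/eqP; rewrite Eav eq_sym eq_invg_mul -expgS a3.
have [s Vs sa] : exists2 s, s \in V & a ^ s = a^-1.
  apply/exists_eq_inP; apply: contraR nab => /exists_inPn noinv.
  rewrite defG abelianY cycle_abelian cVV; apply/centsP=> v Vv w /cycleP[k ->].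
  apply/commuteX/commute_sym/commgP/conjg_fixP.
  by case: (aJ v Vv) => // /eqP av; case/negP: (noinv v Vv).
have nas : a ^ s != a.
  by apply: contraNneq nta => fix_a; rewrite (cent_inverted (isT : odd 3) a3 fix_a sa).
have sa_rel : s * a = a ^+ 2 * 1 ^+ 0 * s.
  have -> : a ^+ 2 = a^-1 by apply/eqP; rewrite eq_sym eq_invg_mul -expgS a3.
  by rewrite mulg1 [RHS]conjgC conjVg sa invgK.
have ord_gen v : v \in V -> #[v] = 4 -> V :=: <[v]>.
  by move=> Vv ov; apply/esym/eqP; rewrite eqEcard cycle_subG Vv oV -orderE ov.
have ord2 v : v \in V -> v != 1 -> #[v] = 2 \/ #[v] = 4.
  move=> Vv ntv; have := cardSg (_ : <[v]> \subset V); rewrite cycle_subG Vv oV -orderE.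
  move/(_ isT); rewrite -order_gt1 in ntv.
  by move: ntv; case: #[v] => [|[|[|[|[|k]]]]] //; auto; move=> _ /dvdn_leq/(_ isT).
have os : #[s] = 4.
  have [||//] := ord2 s Vs; first by apply: contraNneq nas => ->; rewrite conjg1.
  move=> os; exfalso; have Gs := subsetP sVG s Vs.
  have [t Vt ts] : exists2 t, t \in V & t \notin <[s]>.
    apply/subsetPn; apply: contraL isT => /subset_leq_card.
    by rewrite oV -orderE os.
  have [z Vz [zs az]] : exists2 z, z \in V & z \notin <[s]> /\ a ^ z = a.
    case: (aJ t Vt) => at_; first by exists t.
    exists (t * s); first by rewrite groupM.
    by rewrite groupMr ?cycle_id // conjgM at_ conjVg sa invgK.
  have ntz : z != 1 by apply: contraNneq zs => ->.
  have oz : #[z] = 2.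
    have [//|oz] := ord2 z Vz ntz; have : s \in <[z]> by rewrite -ord_gen.
    case/cycleP=> k Es; case/eqP: nas; apply/conjg_fixP/commgP.
    by rewrite Es; apply/commuteX/commgP/conjg_fixP.
  have nsz : <[z]> <| G.
    rewrite /normal cycle_subG (subsetP sVG) //= cents_norm // cent_cycle defG.
    rewrite join_subG cycle_subG sub_cent1 (subsetP cVV) // andbT.
    by apply/cent1P/commgP/conjg_fixP.
  have nss : <[s]> <| G.
    by apply: (BI_normal BI nsz); rewrite ?cycle_subG // -!orderE oz os.
  have : s ^ a \in <[s]>.
    by rewrite memJ_norm ?cycle_id // (subsetP (normal_norm nss)).
  rewrite cycle2g // !inE conjg_eq1 -order_eq1 os /= => /eqP/conjg_fixP/commgP.
  by move/commute_sym/commgP/conjg_fixP/eqP; rewrite (negbTE nas).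
split; first by rewrite oG.
exists a, 1, s; split.
- split; rewrite ?expg1n ?a3 //; first by rewrite -os expg_order.
  by split; [exact: commute1 | exact: sa_rel | rewrite mulg1 !mul1g].
- by split=> //; rewrite (subsetP sVG).
by rewrite defG join_subG (ord_gen s) // !cycle_subG !mem_gen // !inE eqxx ?orbT.
Qed.

(** Here <a> is its own normaliser, hence a Frobenius complement, and the kernel K
    has order 4. The action of a on K has order 3 and moves u, so K is elementary
    abelian and u, f u, f (f u) are its involutions. *)
Lemma alternating_presentation a : #|G| = 12 -> a \in G -> #[a] = 3 ->
  ~~ (<[a]> <| G) -> has_presentation 2 2 3 0 1 1 1 0 G.
Proof.
move=> oG Ga oa nnQ; pose Q := <[a]>%G.
have sQG : Q \subset G by rewrite cycle_subG.
have oQ : #|Q| = 3 by rewrite -orderE.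
have sylQ : 3.-Sylow(G) Q by rewrite pHallE sQG oQ oG p_part.
have nQQ : 'N_G(Q) = Q.
  have sQN : Q \subset 'N_G(Q) by rewrite subsetI sQG normG.
  have := card_Syl_mod G (isT : prime 3); rewrite (card_Syl sylQ) => mod3.
  have div12 : #|G : 'N_G(Q)| %| 12 by rewrite -oG dvdn_indexg.
  have neq1 : #|G : 'N_G(Q)| != 1%N.
    apply: contra nnQ => /eqP/index1g => <-; rewrite ?subsetIl //.
    by rewrite normalSG.
  have oGN : #|G : 'N_G(Q)| = 4.
    have := dvdn_leq (isT : 0 < 12) div12; move: #|_ : _| mod3 div12 neq1 => i.
    by do 13?[case: i => [|i] //].
  apply/esym/eqP; rewrite eqEcard sQN oQ.
  by rewrite -(leq_pmul2r (isT : 0 < 4)) -{1}oGN Lagrange ?subsetIl // oG.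
have frobQ : [Frobenius G with complement Q].
  apply/andP; split; first by apply: contraNneq nnQ => <-; apply: normal_refl.
  apply/normedTI_memJ_P; split=> //; first by rewrite setD_eq0 subG1 -cardG_gt1 oQ.
  move=> x g /setD1P[ntx Qx] Gg; apply/idP/idP=> [/setD1P[_ Qxg] | Qg]; last first.
    have nQg : g \in 'N(Q^#) by rewrite normD1 (subsetP (normG Q)).
    by rewrite memJ_norm // in_setD1 ntx.
  have defQ : Q :=: <[x]>.
    have ox : #[x] = 3 by apply: nt_prime_order; rewrite // -oQ expg_cardG.
    by apply/esym/eqP; rewrite eqEcard cycle_subG Qx oQ -orderE ox.
  by rewrite -nQQ inE Gg inE {1}defQ -cycleJ cycle_subG.
have [K frobK] := Frobenius_kernel_exists frobQ.
have [defG _ ] := andP frobK; have [nsKG _ mulKQ nKQ tiKQ] := sdprod_context (eqP defG).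
have oK : #|K| = 4.
  by apply/eqP; rewrite -(eqn_pmul2r (isT : 0 < 3)) -[X in _ == X]oG -oQ -mulKQ TI_cardMg.
pose f x := x ^ a^-1.
have Kf x : x \in K -> f x \in K.
  by move=> Kx; rewrite memJ_norm // groupV (subsetP nKQ) ?cycle_id.
have f3 x : f (f (f x)) = x.
  by rewrite /f -!conjgM -[_ * _]/(a^-1 ^+ 3) expgVn -oa expg_order invg1 conjg1.
have f_inj : injective f by apply: conjg_inj.
have fE x : a * x = f x * a by rewrite /f conjgE invgK mulgA mulgKV.
have [u Ku fu] : exists2 u, u \in K & f u != u.
  apply/exists_inP; apply: contraR nnQ => /exists_inPn fix_f.
  rewrite -[<[a]>]/(gval Q) /normal sQG -mulKQ mul_subG ?normG // cents_norm // cent_cycle.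
  apply/subsetP=> x Kx; apply/cent1P; have /negPn/eqP fx := fix_f x Kx.
  by rewrite /commute fE fx.
have cKK : abelian K by apply: (card_p2group_abelian (isT : prime 2)).
have ntu : u != 1 by apply: contraNneq fu => ->; rewrite /f conj1g.
have u2 : u ^+ 2 = 1.
  have fX k : f (u ^+ k) = f u ^+ k by apply: conjXg.
  have u4 : u ^+ 4 = 1 by rewrite -oK expg_cardG.
  apply/eqP/negPn/negP=> nt_u2; have ou : #[u] = 4.
    have : #[u] %| (2 ^ 2)%N by rewrite order_dvdn u4.
    case/dvdn_pfactor=> // k; rewrite leq_eqVlt => /predU1P[-> // | lt_k2] ou.
    by case/negP: nt_u2; rewrite -order_dvdn ou -[X in _ %| X]/(2 ^ 1)%N dvdn_exp2l.
  have defK : <[u]> = K by apply/eqP; rewrite eqEcard cycle_subG Ku oK -orderE ou.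
  have /cyclePmin[i] : f u \in <[u]> by rewrite defK Kf.
  rewrite ou; case: i => [|[|[|[|]]]] // _ fui.
  - by rewrite -(conjg_eq1 u a^-1) -/(f u) fui eqxx in ntu.
  - by rewrite fui eqxx in fu.
  - by case/eqP: nt_u2; apply: f_inj; rewrite fX fui -expgM u4 /f conj1g.
  have fuV : f u = u^-1 by rewrite fui; apply/eqP; rewrite eq_sym eq_invg_mul -expgS u4.
  have ffu : f (f u) = u by rewrite fuV /f conjVg -/(f u) fuV invgK.
  by case/eqP: fu; rewrite -[RHS]f3 ffu.
have f_ord x : x ^+ 2 = 1 -> f x ^+ 2 = 1 by move=> x2; rewrite /f -conjXg x2 conj1g.
have ord2 (x : gT) : x != 1 -> x ^+ 2 = 1 -> #[x] = 2 by move=> ntx x2; apply: nt_prime_order.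
have ntfu : f u != 1 by rewrite conjg_eq1.
have ou := ord2 u ntu u2; have ofu := ord2 _ ntfu (f_ord u u2).
have defK : <[u]> * <[f u]> = K.
  apply/eqP; rewrite eqEcard mul_subG ?cycle_subG ?Kf //= oK.
  rewrite TI_cardMg /= -?orderE ?ou ?ofu // prime_TIg /= -?orderE ?ou //.
  by rewrite cycle_subG /= cycle2g // !inE negb_or ntu eq_sym.
have ffu : f (f u) = u * f u.
  have : f (f u) \in <[u]> * <[f u]> by rewrite defK !Kf.
  case/mulsgP=> x y; rewrite !cycle2g // !inE.
  case/orP=> /eqP-> /orP[] /eqP-> //; rewrite ?mul1g ?mulg1 => ffu.
  - case/eqP: ntu; apply/eqP; rewrite -(conjg_eq1 u a^-1) -(conjg_eq1 _ a^-1).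
    by rewrite -/(f u) -/(f (f u)) ffu.
  - by case/eqP: fu; apply: f_inj.
  by case/eqP: fu; rewrite -[RHS]f3 ffu.
split; first by rewrite oG.
exists u, (f u), a; split.
- split; [exact: u2 | exact: f_ord | by rewrite -oa expg_order | split].
  - exact: (centsP cKK _ Ku _ (Kf u Ku)).
  - by rewrite mul1g fE.
  by rewrite fE ffu.
- by split=> //; apply: (subsetP (normal_sub nsKG)); rewrite ?Kf.
by rewrite -mulKQ -defK !mul_subG // cycle_subG mem_gen // !inE eqxx ?orbT.
Qed.

Lemma order12_presentation : BI_group G -> ~~ abelian G -> #|G| = 12 ->
  has_presentation 3 1 4 2 0 0 0 0 G \/ has_presentation 2 2 3 0 1 1 1 0 G.
Proof.
move=> BI nab oG.
have [a Ga oa] : {a | a \in G & #[a] = 3} by apply: Cauchy; rewrite // oG.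
have [nsaG | nnaG] := boolP (<[a]> <| G).
  by left; apply: dicyclic_presentation nsaG oa.
by right; apply: alternating_presentation nnaG.
Qed.

(** An automorphism of order dividing 3 of the cyclic group of order 5 is trivial. *)
Lemma order15_abelian : #|G| = 15 -> abelian G.
Proof.
move=> oG; have [P sylP] := Sylow_exists 5 G; have [sPG _ _] := and3P sylP.
have oP : #|P| = 5 by rewrite (card_Hall sylP) oG p_part.
have nsPG : P <| G.
  have := card_Syl_mod G (isT : prime 5); rewrite (card_Syl sylP) => mod5.
  have div15 : #|G : 'N_G(P)| %| 15 by rewrite -oG dvdn_indexg.
  have i1 : #|G : 'N_G(P)| = 1%N.
    have := dvdn_leq (isT : 0 < 15) div15; move: #|G : _| mod5 div15 => i.
    by do 16?[case: i => [|i] //].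
  by have := index1g (subsetIl G 'N(P)) i1 => <-; rewrite normalSG.
have /cyclicP[a defP] : cyclic P by rewrite prime_cyclic // oP.
have oa : #[a] = 5 by rewrite orderE -defP.
have [c Gc oc] : {c | c \in G & #[c] = 3} by apply: Cauchy; rewrite // oG.
have defG : G :=: P <*> <[c]>.
  apply: (@sub_coprime_card P <[c]>%G); rewrite ?joing_subl ?joing_subr //=.
  - by rewrite oP -orderE oc.
  - by rewrite oG oP -orderE oc.
  by rewrite join_subG sPG cycle_subG.
have nPc : c \in 'N(<[a]>) by rewrite -defP (subsetP (normal_norm nsPG)).
have /cyclePmin[i lti ac]: a ^ c \in <[a]> by rewrite memJ_norm ?cycle_id.
rewrite oa in lti.
have aJ k : a ^ (c ^+ k) = a ^+ (i ^ k).
  by elim: k => [|k IHk]; rewrite ?conjg1 // expgSr conjgM IHk conjXg ac -expgM expnS.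
have i3 : (i ^ 3 == 1 %[mod 5])%N.
  by rewrite -oa -eq_expg_mod_order -aJ -oc expg_order conjg1.
have i1 : i = 1%N.
  by move: lti (eqP i3); clear; do 5?[case: i => [|i] //].
rewrite defG defP abelianY !cycle_abelian /= cycle_subG -sub_cent1 cycle_subG.
by apply/cent1P/commgP/conjg_fixP; rewrite ac i1.
Qed.

Lemma order_2q_presentation q : BI_group G -> ~~ abelian G -> #|G| = (q * 2)%N ->
    q \in [:: 3; 5; 7; 9] ->
  has_presentation q 1 2 q.-1 0 0 0 0 G \/ q = 9 /\ has_presentation 3 3 2 2 0 0 2 0 G.
Proof.
move=> BI nab oG q_in; pose p := pdiv q.
have [odd_q p_pr oq le_log] : [/\ odd q, prime p, ((q * 2)`_p)%N = q & logn p q <= 2].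
  by rewrite p_part /p; move: q_in; rewrite !inE => /or4P[] /eqP->.
have [P sylP] := Sylow_exists p G; have [sPG pP _] := and3P sylP.
have oP : #|P| = q by rewrite (card_Hall sylP) oG.
have cPP : abelian P by apply: (p2group_abelian pP); rewrite oP.
have [b Gb ob] : {b | b \in G & #[b] = 2} by apply: Cauchy; rewrite // oG dvdn_mull.
have [cycP | ncycP] := boolP (cyclic P).
  left; apply: (dihedral_presentation odd_q oG oP sPG cPP Gb ob nab cycP).
  move: q_in; rewrite !inE => /or4P[] /eqP-> i; do 9?[case: i => [|i] //]; auto.
have q9 : q = 9.
  have : ~~ prime q by apply: contra ncycP => q_pr; rewrite prime_cyclic ?oP.
  by move: q_in; rewrite !inE => /or4P[] /eqP->.
right; split=> //; apply: (elementary_presentation odd_q oG oP sPG cPP Gb ob) => // x Px.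
have : #[x] %| (3 ^ 2)%N by rewrite -[(3 ^ 2)%N]q9 -oP order_dvdG.
case/dvdn_pfactor=> // k; rewrite leq_eqVlt => /predU1P[-> ox | lt_k2 ox].
  case/cyclicP: ncycP; exists x; apply/esym/eqP.
  by rewrite eqEcard cycle_subG Px oP q9 -orderE ox.
by apply/eqP; rewrite -order_dvdn ox -[X in _ %| X]/(3 ^ 1)%N dvdn_exp2l.
Qed.

End SmallGroups.

(** The orders below 20 left are 8 and 16, the numbers 2q, and 12. The groups that
    survive are tested by [CI_check]; [len] is the least bound on the length of
    walks that separates the orbits for the largest group in each case. *)
Lemma small_BI_is_CI (gT : finGroupType) (G : {group gT}) :
  ~~ abelian G -> BI_group G -> #|G| < 20 -> CI_group G.
Proof.
move=> nab BI lt20.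
have nab_prime : ~~ prime #|G|.
  by apply: contra nab => /prime_cyclic/cyclic_abelian.
have nab_p2 p : prime p -> #|G| <> (p ^ 2)%N.
  by move=> p_pr /(card_p2group_abelian p_pr) cGG; rewrite cGG in nab.
have : #|G| \in [:: 8; 16; 6; 10; 14; 18; 12].
  have := cardG_gt0 G; have : #|G| <> 1%N.
    by move=> o1; rewrite (card_le1_trivg _) ?o1 // abelian1 in nab.
  have : #|G| <> 15 by move/order15_abelian => cGG; rewrite cGG in nab.
  move: (nab_p2 2 isT) (nab_p2 3 isT) nab_prime lt20; clear; move: #|G| => n.
  by do 20?[case: n => [|n] //].
have two_group n : n <= 4 -> #|G| = (2 ^ n)%N -> CI_group G.
  move=> le_n4 oG; have pres := quaternion_presentation BI nab oG le_n4.
  by apply: (CI_of_presentation (len := 3) pres); vm_compute.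
have two_q q : q \in [:: 3; 5; 7; 9] -> #|G| = (q * 2)%N -> CI_group G.
  move=> q_in oG; have [presD | [_ presE]] := order_2q_presentation BI nab oG q_in.
    apply: (CI_of_presentation (len := 10) presD).
    by move: q_in; rewrite !inE => /or4P[] /eqP->; vm_compute.
  by apply: (CI_of_presentation (len := 5) presE); vm_compute.
rewrite !inE => /or4P[/eqP o8 | /eqP o16 | /eqP o6 | /or4P[] /eqP oG].
- exact: (two_group 3).
- exact: (two_group 4).
- exact: (two_q 3).
- exact: (two_q 5).
- exact: (two_q 7).
- exact: (two_q 9).
have [pres | pres] := order12_presentation BI nab oG.
  by apply: (CI_of_presentation (len := 5) pres); vm_compute.
by apply: (CI_of_presentation (len := 4) pres); vm_compute.
Qed.

(** * The Frobenius group of order 20 *)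

(** Multiplication by 3 is an automorphism of order 4 of the integers modulo 5. *)
Lemma F20_exists : [set: Extremal.gtype 5 4 3] \isog
  Grp (a : b : a ^+ 5, b ^+ 4, a ^ b = a ^+ 3).
Proof.
apply: Extremal.Grp => //.
have o1 : #[Zp1 : 'Z_5] = 5 by rewrite order_Zp1.
have unit3 : (3%:R : 'Z_#[Zp1 : 'Z_5])%R \is a GRing.unit by rewrite unitZpE ?o1.
pose u := FinRing.unit 'Z_#[Zp1 : 'Z_5] unit3.
exists (Zp_unitm u); rewrite Aut_aut order_injm ?injm_Zp_unitm ?in_setT //; split=> //.
  rewrite order_dvdn -val_eqE /=.
  by rewrite -val_eqE /= o1.
apply/eqP; rewrite autE ?cycle_id // eq_expg_mod_order /=.
by rewrite o1.
Qed.

(** Since a^b = a^3, conversely b a b^-1 = a^2. The order is that of the semidirect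
    product of [F20_exists], because two groups with the same presentation are
    images of each other. *)
Lemma F20_presentation (gT : finGroupType) (G : {group gT}) :
  G \isog Grp (a : b : a ^+ 5, b ^+ 4, a ^ b = a ^+ 3) ->
  has_presentation 5 1 4 2 0 0 0 0 G.
Proof.
move=> isoG.
have oG : #|G| = 20.
  have homF := isoGrp_hom F20_exists; have homG := isoGrp_hom isoG.
  have isoGF : G \isog [set: Extremal.gtype 5 4 3].
    by rewrite isogEhom F20_exists homG isoG homF.
  by rewrite (card_isog isoGF) Extremal.card.
split; first by rewrite oG.
have /existsP[[a b]] := isoGrp_hom isoG; rewrite /= !xpair_eqE.
case/and4P=> [/eqP defG /eqP a5 /eqP b4 /eqP ab].
exists a, 1, b; split.
- split; rewrite ?expg1n //; split; first exact: commute1.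
    (* a^2 b = b (a^2)^b = b a^6 *)
    rewrite mulg1 [RHS]conjgC conjXg ab -expgM.
    by rewrite -[(3 * 2)%N]/(5 + 1)%N expgD a5 mul1g.
  by rewrite !mulg1 !mul1g.
- by split; rewrite // -cycle_subG -defG ?joing_subl ?joing_subr.
by rewrite -defG join_subG !cycle_subG !mem_gen // !inE eqxx ?orbT.
Qed.

Lemma F20_nonabelian (gT : finGroupType) (G : {group gT}) :
  has_presentation 5 1 4 2 0 0 0 0 G -> ~~ abelian G.
Proof.
move=> [cardG [a1 [a2 [b [rel [Ga1 _ Gb] sGK]]]]].
have [_ a2_1 b4 [_ ba1 _]] := rel; rewrite expg1 in a2_1.
apply/negP=> /centsP cGG; have a1_1 : a1 = 1.
  by apply: (mulIg (a1 * b)); rewrite mul1g mulgA -(cGG b Gb a1 Ga1) ba1 mulg1.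
have : G \subset <[b]>.
  apply: subset_trans sGK _; rewrite a1_1 a2_1 gen_subG !subUset !sub1set.
  by rewrite group1 cycle_id.
move/subset_leq_card; rewrite cardG -orderE.
have := dvdn_leq (isT : 0 < 4) (_ : #[b] %| 4); rewrite order_dvdn b4 eqxx.
by move=> /(_ isT) le4 /leq_trans/(_ le4).
Qed.

(** S consists of b, a and ab with their inverses, T of b, a and ab^3 with their
    inverses. Consider the cosets of <a> as four fibres in a circle, with points
    a^i b^k. In both graphs the fibre at k is a pentagon with steps 2^k or -2^k.
    From the fibre at k to the one at k + 1, S joins i to i and i + 2^k; after the
    reflection k |-> -k, T joins i to i and i + (-1)^k 2^k. Shifting the fibres by
    0, 0, -2, -2 turns one rule into the other. No automorphism can do this:
    each of the candidates is tested. *)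
Lemma F20_not_CI (gT : finGroupType) (G : {group gT}) :
  has_presentation 5 1 4 2 0 0 0 0 G -> ~ CI_group G.
Proof.
case/has_presentationP=> a1 [a2 [b [n_gt0 rel genG cardG]]].
apply: (nonCI_presentedP n_gt0 rel genG cardG
  (phi := fun p => ((p.1.1 + 3 * (1 < p.2)) %% 5, 0, (4 - p.2) %% 4)%N)
  (ls := [:: (0, 0, 1); (0, 0, 3); (1, 0, 0); (4, 0, 0); (1, 0, 1); (2, 0, 3)]%N)
  (lt := [:: (0, 0, 1); (0, 0, 3); (1, 0, 0); (4, 0, 0); (1, 0, 3); (3, 0, 1)]%N)).
by vm_compute.
Qed.

(** Reason for the success of the check: in the spectrum of Cay(G, S) the four
    linear characters contribute the eigenvalues |S|, n5 + n2 - n4 and, twice,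
    n5 - n2, where nd is the number of elements of order d in S, and the remaining
    eigenvalues have multiplicities divisible by 4. So the multiplicities modulo 4
    and the vanishing of the trace recover n5, n2 and n4, which count the elements
    of S in each real class. *)
Lemma F20_BI (gT : finGroupType) (G : {group gT}) :
  has_presentation 5 1 4 2 0 0 0 0 G -> BI_group G.
Proof. by move=> presG; apply: (BI_of_presentation (len := 6) presG); vm_compute. Qed.

Theorem theorem1p5 :
  (exists (gT : finGroupType) (G : {group gT}),
     G \isog Grp (a : b : a ^+ 5, b ^+ 4, a ^ b = a ^+ 3)) /\
  (forall (gT : finGroupType) (G : {group gT}),
     G \isog Grp (a : b : a ^+ 5, b ^+ 4, a ^ b = a ^+ 3) ->
     [/\ #|G| = 20%N, ~~ abelian G, BI_group G, ~ CI_group G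
       & forall (hT : finGroupType) (H : {group hT}),
           ~~ abelian H -> BI_group H -> ~ CI_group H -> (#|G| <= #|H|)%N]).
Proof.
split; first by exists _, [set: Extremal.gtype 5 4 3]%G; apply: F20_exists.
move=> gT G isoG; have pres := F20_presentation isoG; have [oG _] := pres.
split=> //.
- exact: F20_nonabelian.
- exact: F20_BI.
- exact: F20_not_CI.
move=> hT H nabH BI_H nCI_H; rewrite oG leqNgt; apply/negP => lt20.
exact/nCI_H/small_BI_is_CI.
Qed.
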